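(* Let $d\geq1$, $\frac{d-2}2\leq\beta\leq\frac d2$, $\theta:=\frac{d-2\beta}2$, and $2\leq q\leq\infty$. Say that $( * )$ holds if there is a finite constant $K=K(q,\beta,d)$ such that for all $u\in H^1(\mathbb{R}_+,(1+t)^{d-1})$ \[ \left(\int_0^\infty|u|^q(1+t)^{\beta q-1}dt\right)^{2/q}\leq K\left(\int_0^\infty|u'|^2(1+t)^{d-1}dt\right)^\theta\left(\int_0^\infty|u|^2(1+t)^{d-1}dt\right)^{1-\theta}, \] where for $q=\infty$ the left side is replaced by $\sup_t|u(t)|^2(1+t)^{2\beta}$. Then: (1) If $1<d\leq2$ and $0<\beta\leq\frac{d-1}2$, or if $d>2$ and $\frac{d-2}2\leq\beta\leq\frac{d-1}2$, then $( * )$ holds for all $2\leq q\leq\infty$. (2) If $d\geq1$ and $\frac{d-1}2<\beta\leq\frac d2$, then $( * )$ holds for all $2\leq q\leq(\beta-\frac{d-1}2)^{-1}$. (3) If $1\leq d<2$ and $\beta=0$, then $( * )$ holds for $q=\infty$. (4) If $1\leq d\leq2$ and $-\frac{2-d}2\leq\beta\leq0$, then $( * )$ does not hold for $2\leq q<\infty$. (5) If $1\leq d<2$ and $-\frac{2-d}2\leq\beta<0$, or if $d=2$ and $\beta=0$, then $( * )$ does not hold for $q=\infty$. (6) If $d\geq1$ and $\frac{d-1}2<\beta\leq\frac d2$, then $( * )$ does not hold for $(\beta-\frac{d-1}2)^{-1}<q\leq\infty$.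
   Context: $H^1(\mathbb{R}_+,(1+t)^{d-1})$ is the space of $u\in H^1_{\mathrm{loc}}(\mathbb{R}_+)$ with $\int_0^\infty(|u'|^2+|u|^2)(1+t)^{d-1}dt<\infty$. *)

(* Defs.v *)
From HB Require Import structures.
From mathcomp Require Import all_boot all_order all_algebra.
From mathcomp Require Import all_classical all_reals all_analysis.
Set Implicit Arguments. Unset Strict Implicit. Unset Printing Implicit Defensive.
Import Order.TTheory GRing.Theory Num.Theory.
Import numFieldNormedType.Exports.
Local Open Scope classical_set_scope.
Local Open Scope ring_scope.

Section Defs.
Context {R : realType}.
Notation mu := (@lebesgue_measure R).

Definition int_pos (f : R -> R) : \bar R :=
  (\int[mu]_(t in `]0%R, +oo[) (f t)%:E)%E.

Definition wgt (d t : R) : R := (1 + t) `^ (d - 1).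

(* [H1w d u g]: u belongs to H^1(R_+, (1+t)^(d-1)) and g is its (weak)
   derivative.  H^1_loc on the interval ]0,+oo[ is rendered through the
   locally absolutely continuous representative: g is locally integrable and
   u y - u x = int_x^y g for all 0 < x <= y. *)
Definition H1w (d : R) (u g : R -> R) : Prop :=
  [/\ (forall x y : R, 0 < x -> x <= y ->
         mu.-integrable `[x, y] (fun t => (g t)%:E) /\
         ((u y - u x)%:E = \int[mu]_(t in `[x, y]) (g t)%:E)%E),
      measurable_fun (`]0%R, +oo[ : set R) g,
      (int_pos (fun t => (g t ^+ 2 * wgt d t)%R) < +oo)%E &
      (int_pos (fun t => (u t ^+ 2 * wgt d t)%R) < +oo)%E].

Definition lhs (beta : R) (q : \bar R) (u : R -> R) : \bar R :=
  match q with
  | r%:E => poweR (int_pos (fun t => `|u t| `^ r * (1 + t) `^ (beta * r - 1)))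
                  (2 / r)
  | +oo%E => ereal_sup [set ((`|u t| ^+ 2 * (1 + t) `^ (2 * beta))%:E)
                          | t in `]0%R, +oo[]
  | -oo%E => +oo%E (* irrelevant: q >= 2 always *)
  end.

Definition Star (d beta : R) (q : \bar R) : Prop :=
  exists K : R, forall u g : R -> R, H1w d u g ->
    (lhs beta q u <=
      (K * (fine (int_pos (fun t => g t ^+ 2 * wgt d t))) `^ ((d - 2 * beta) / 2)
         * (fine (int_pos (fun t => u t ^+ 2 * wgt d t))) `^ (1 - (d - 2 * beta) / 2))%:E)%E.

End Defs.

(* Main.v *)
Require Import Defs.
From HB Require Import structures.
From mathcomp Require Import all_boot all_order all_algebra.
From mathcomp Require Import all_classical all_reals all_analysis.
From mathcomp Require Import measurable_realfun ring lra.
Set Implicit Arguments. Unset Strict Implicit. Unset Printing Implicit Defensive.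
Import Order.TTheory GRing.Theory Num.Theory.
Import numFieldNormedType.Exports.
Local Open Scope classical_set_scope.
Local Open Scope ring_scope.

(** Write s = 1 + t, A = int |u'|^2 s^(d-1), B = int |u|^2 s^(d-1), and
    h = sqrt (B / A), so that A^theta B^(1-theta) = A h^(2-d+2 beta); if A or B
    vanishes then u = 0.  The basic tool is the Cauchy-Schwarz bound
    (u y - u x)^2 <= int_x^y |u'|^2 s^a * int_x^y s^(-a) for well-chosen a.
    Taking a = d - 1 and averaging over a window of length h gives
    u(t)^2 s^(d-1) <= 4 h A everywhere.  For s >= h this already controls both
    sup u^2 s^(2 beta) and int u^2 s^(2 beta - 1) by A h^(2-d+2 beta); for
    s <= h one compares u(t) with its value at s = h, with a = 1 + 2 beta for
    the supremum (a = d - 1 if beta = 0), and with a = 1 + beta followed by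
    Tonelli for the integral.  Finite q >= 2 follow from
    |u|^q s^(beta q - 1) <= (sup u^2 s^(2 beta))^(q/2 - 1) u^2 s^(2 beta - 1) when
    2 beta <= d - 1, and otherwise from z^(q/2) <= z + z^p with
    2 p = (beta - (d-1)/2)^-1, where the p-th power is handled by the bound on
    u^2 s^(d-1).
    The negative results are witnessed by a bump of fixed width escaping to
    infinity (large beta), by the linear ramp from 1 at 0 to 0 at L with
    L -> oo (beta <= 0), and by a logarithmic ramp (d = 2, beta = 0, q = oo). *)

(** * Power weights and the Cauchy-Schwarz increment bound *)

Section Integrals.
Context {R : realType}.
Notation mu := (@lebesgue_measure R).
Implicit Types (a x y t : R) (f F : R -> R).

Lemma integral_deriv f F x y : x <= y ->
  (forall t, x <= t <= y -> is_derive t 1 F (f t)) ->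
  (forall t, x <= t <= y -> {for t, continuous f}) ->
  (\int[mu]_(t in `[x, y]) (f t)%:E = (F y - F x)%:E)%E.
Proof.
rewrite le_eqVlt => /predU1P[->|xy] dF cf.
  by rewrite set_itv1 integral_set1 subrr.
have cF t : x <= t <= y -> {for t, continuous F}.
  move=> /dF dFt; apply: differentiable_continuous.
  by apply/derivable1_diffP; exact: ex_derive.
rewrite (@continuous_FTC2 _ f F)// ?EFinB//.
- apply: continuous_in_subspaceT => t; rewrite inE/= in_itv/=; exact: cf.
- split.
  + move=> t; rewrite in_itv/= => /andP[xt ty].
    by have := dF t; rewrite !ltW// => /(_ isT) ?; exact: ex_derive.
  + apply: cvg_at_right_filter; apply: cF; rewrite lexx ltW//.
  + apply: cvg_at_left_filter; apply: cF; rewrite lexx ltW//.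
- move=> t; rewrite in_itv/= => /andP[xt ty].
  have := dF t; rewrite !ltW// => /(_ isT) ?.
  by rewrite derive1E derive_val.
Qed.

Lemma is_derive_powR1D a t : 0 <= t ->
  is_derive t 1 (fun s : R => (1 + s) `^ a) (a * (1 + t) `^ (a - 1)).
Proof.
move=> t0; have t1 : 0 < 1 + t by lra.
have ? := is_derive1_powR a t1.
have h : is_derive t 1 (fun s : R => 1 + s) 1.
  by have := is_deriveD (is_derive_cst (1:R) t 1) (is_derive_id t (1:R)); rewrite add0r.
rewrite -[X in is_derive _ _ _ X]mulr1.
exact: (@is_derive1_comp _ (fun s : R => s `^ a) (fun s : R => 1 + s)).
Qed.

Lemma continuous_powR1D a t : 0 <= t ->
  {for t, continuous (fun s : R => (1 + s) `^ a)}.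
Proof.
move=> /(is_derive_powR1D a) h; apply: differentiable_continuous.
by apply/derivable1_diffP; exact: ex_derive.
Qed.

Lemma integral_powR1D a x y : a != 0 -> 0 <= x -> x <= y ->
  (\int[mu]_(t in `[x, y]) ((1 + t) `^ (a - 1))%:E =
   (((1 + y) `^ a - (1 + x) `^ a) / a)%:E)%E.
Proof.
move=> a0 x0 xy.
have dF t : x <= t <= y ->
    is_derive t 1 (fun t => a^-1 * (1 + t) `^ a) ((1 + t) `^ (a - 1)).
  move=> /andP[xt ty]; have dt := is_derive_powR1D a (le_trans x0 xt).
  rewrite -[X in is_derive _ _ _ X](mulKf a0).
  exact: (@is_deriveZ _ _ _ (fun s : R => (1 + s) `^ a) a^-1).
rewrite (integral_deriv xy dF) ?mulrBl 1?mulrC 1?[X in _ - X]mulrC//.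
by move=> t /andP[xt _]; exact: continuous_powR1D (le_trans x0 xt).
Qed.

Lemma measurable_powR1D a D : measurable_fun D (fun t : R => (1 + t) `^ a).
Proof.
apply: measurable_funTS; apply: (measurableT_comp (measurable_powR a)).
exact: measurable_funD.
Qed.

(** Turns a one-parameter family of Young bounds back into a product bound: for D > 0 and P > 0 the
    optimal parameter is l = D / P. *)
Lemma sqr_le_of_young (D P Q : R) : 0 <= P -> 0 <= Q ->
  (forall l, 0 < l -> 2 * D <= l * P + l^-1 * Q) -> D <= 0 \/ D ^+ 2 <= P * Q.
Proof.
move=> P0 Q0 H; have [?|D0] := leP D 0; [by left|right].
have [P00|Pn0] := eqVneq P 0.
  (* If P = 0 this l turns the right side into D Q / (Q + 1) < D, which contradicts D > 0. *)
  have := H ((Q + 1) / D) ltac:(by rewrite divr_gt0//; lra).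
  rewrite P00 mulr0 add0r invf_div mulrAC ler_pdivlMr; last lra.
  by move=> ?; nra.
have Pp : 0 < P by rewrite lt_neqAle eq_sym Pn0.
have := H (D / P) ltac:(by rewrite divr_gt0).
rewrite invf_div divfK// => h.
have {h} h : D <= P / D * Q by lra.
by move: h; rewrite mulrAC ler_pdivlMr// expr2.
Qed.

(** The Young bounds |g| <= (l / 2) g^2 s^a + (2 l)^-1 s^(-a) are integrated over the segment and
    then optimised in l. [P] and [Q] are real upper bounds rather than the integrals themselves, so
    the conclusion stays in the reals. *)
Lemma cauchy_schwarz_increment (u g : R -> R) a x y P Q :
  0 < x -> x <= y ->
  mu.-integrable `[x, y] (fun t => (g t)%:E) ->
  ((u y - u x)%:E = \int[mu]_(t in `[x, y]) (g t)%:E)%E ->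
  0 <= P -> 0 <= Q ->
  (\int[mu]_(t in `[x, y]) (g t ^+ 2 * (1 + t) `^ a)%:E <= P%:E)%E ->
  (\int[mu]_(t in `[x, y]) ((1 + t) `^ (- a))%:E <= Q%:E)%E ->
  (u y - u x) ^+ 2 <= P * Q.
Proof.
move=> x0 xy ig ug P0 Q0 hP hQ.
have mg : measurable_fun `[x, y] g.
  by apply/measurable_EFinP; exact: measurable_int ig.
have mg2 : measurable_fun `[x, y] (fun t => g t ^+ 2 * (1 + t) `^ a).
  by apply: measurable_funM; [exact: measurable_funX|exact: measurable_powR1D].
have young l : 0 < l -> 2 * `|u y - u x| <= l * P + l^-1 * Q.
  move=> l0.
  suff : (`|u y - u x|%:E <= (l / 2 * P + (2 * l)^-1 * Q)%:E)%E.
    rewrite lee_fin => h; have -> : l * P + l^-1 * Q =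
        2 * (l / 2 * P + (2 * l)^-1 * Q).
      by field; rewrite gt_eqF.
    by rewrite ler_pM2l.
  rewrite -abse_EFin ug.
  apply: le_trans (le_abse_integral _ _ _) _ => //; first exact/measurable_EFinP.
  apply: (@le_trans _ _ (\int[mu]_(t in `[x, y]) ((l / 2)%:E *
      (g t ^+ 2 * (1 + t) `^ a)%:E + ((2 * l)^-1)%:E * ((1 + t) `^ (- a))%:E)))%E.
    apply: ge0_le_integral => //.
    + by apply/measurable_EFinP; exact: measurableT_comp.
    + apply: emeasurable_funD; apply: emeasurable_funM => //; apply/measurable_EFinP => //.
      exact: measurable_powR1D.
    + move=> t /=; rewrite in_itv/= => /andP[xt _]; rewrite lee_fin.
      have s0 : 0 < (1 + t) `^ a by rewrite powR_gt0//; lra.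
      rewrite powRN; move: s0; set s := (1 + t) `^ a => s0.
      rewrite -(normr_id (g t)) -[g t ^+ 2]real_normK ?num_real//.
      have := normr_ge0 (g t); rewrite normr_id; set z := `|g t| => z0.
      (* Completing the square: the gap in Young's inequality is an explicit nonnegative term. *)
      have -> : l / 2 * (z ^+ 2 * s) + (2 * l)^-1 * s^-1 = z + (l * s * z - 1) ^+ 2 * (2 * l * s)^-1.
        by field; rewrite !gt_eqF.
      by rewrite lerDl mulr_ge0 ?sqr_ge0// invr_ge0 !mulr_ge0// ltW.
  rewrite ge0_integralD//; last 4 first.
  + by move=> t _; apply: mule_ge0; rewrite lee_fin; [lra|rewrite mulr_ge0 ?sqr_ge0 ?powR_ge0].
  + by apply: emeasurable_funM => //; exact/measurable_EFinP.
  + by move=> t _; apply: mule_ge0; rewrite lee_fin ?powR_ge0 ?invr_ge0//; lra.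
  + by apply: emeasurable_funM => //; apply/measurable_EFinP; exact: measurable_powR1D.
  rewrite !ge0_integralZl//; last 6 first.
  + by apply/measurable_EFinP; exact: measurable_powR1D.
  + by move=> t _; rewrite lee_fin powR_ge0.
  + by rewrite lee_fin invr_ge0; lra.
  + exact/measurable_EFinP.
  + by move=> t _; rewrite lee_fin mulr_ge0 ?sqr_ge0 ?powR_ge0.
  + by rewrite lee_fin; lra.
  by rewrite EFinD !EFinM leeD// lee_wpmul2l// lee_fin ?invr_ge0; lra.
have [D0|] := sqr_le_of_young P0 Q0 young.
- have := normr_ge0 (u y - u x) => Dge.
  have : `|u y - u x| = 0 by lra.
  by move/eqP; rewrite normr_eq0 => /eqP ->; rewrite expr0n mulr_ge0.
- by rewrite real_normK ?num_real.
Qed.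

End Integrals.

(** * Functions in the weighted Sobolev space *)

Section IntPos.
Context {R : realType}.
Notation mu := (@lebesgue_measure R).
Implicit Types (f k : R -> R) (D : set R) (c x y : R).

Lemma int_pos_ge0 f : (forall t, 0 < t -> 0 <= f t) -> (0 <= int_pos f)%E.
Proof.
move=> f0; apply: integral_ge0 => t /=; rewrite in_itv/= andbT lee_fin; exact: f0.
Qed.

Lemma le_int_pos D k f c : measurable D -> D `<=` (`]0, +oo[ : set R) ->
  measurable_fun (`]0, +oo[ : set R) f -> (forall t, 0 < t -> 0 <= f t) ->
  measurable_fun D k -> (forall t, D t -> 0 <= k t) ->
  0 <= c -> (forall t, D t -> k t <= c * f t) ->
  (\int[mu]_(t in D) (k t)%:E <= c%:E * int_pos f)%E.
Proof.
move=> mD D0 mf f0 mk k0 c0 kcf.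
rewrite /int_pos -ge0_integralZl//; last 2 first.
- exact/measurable_EFinP.
- by move=> t /=; rewrite in_itv/= andbT lee_fin; exact: f0.
have mcf : measurable_fun (`]0, +oo[ : set R) (fun t => c%:E * (f t)%:E)%E.
  by apply: emeasurable_funM => //; exact/measurable_EFinP.
apply: (@le_trans _ _ (\int[mu]_(t in D) (c%:E * (f t)%:E))%E).
  apply: ge0_le_integral => //.
  - exact/measurable_EFinP.
  - exact: measurable_funS mcf.
apply: ge0_subset_integral => //.
- move=> t /=; rewrite in_itv/= andbT => t0.
  by rewrite -EFinM lee_fin mulr_ge0// f0.
Qed.

Lemma integral_segment_cst c x y : x <= y ->
  (\int[mu]_(t in `[x, y]) c%:E = (c * (y - x))%:E)%E.
Proof.
move=> xy; rewrite (integral_cst mu)//= lebesgue_measure_itv/= lte_fin.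
move: xy; rewrite le_eqVlt => /predU1P[->|->]; last by rewrite -EFinD -EFinM.
by rewrite ltxx subrr mulr0 mule0.
Qed.

Lemma segment_pos x y : 0 < x -> (`[x, y] : set R) `<=` `]0, +oo[.
Proof. by move=> x0 t /=; rewrite !in_itv/= andbT => /andP[/(lt_le_trans x0)]. Qed.

End IntPos.

Section H1w_theory.
Context {R : realType}.
Notation mu := (@lebesgue_measure R).
Variables (d : R) (u g : R -> R).
Hypotheses (d1 : 1 <= d) (H : H1w d u g).

Let A : R := fine (int_pos (fun t => g t ^+ 2 * wgt d t)).
Let B : R := fine (int_pos (fun t => u t ^+ 2 * wgt d t)).

Lemma wgt_ge0 t : 0 <= wgt d t.
Proof. exact: powR_ge0. Qed.

Lemma wgt_ge1 t : 0 <= t -> 1 <= wgt d t.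
Proof.
by move=> t0; rewrite /wgt -[leLHS](powRr0 (1 + t)); apply: ler_powR; have := d1; lra.
Qed.

Lemma wgt_homo x y : 0 <= x -> x <= y -> wgt d x <= wgt d y.
Proof.
by move=> x0 xy; apply: ge0_ler_powR; rewrite ?nnegrE; have := d1; lra.
Qed.

Lemma sqr_wgt_ge0 (f : R -> R) t : 0 <= f t ^+ 2 * wgt d t.
Proof. by rewrite mulr_ge0 ?sqr_ge0 ?wgt_ge0. Qed.

Lemma dirichletE : int_pos (fun t => g t ^+ 2 * wgt d t) = A%:E.
Proof.
case: H => _ _ fin _; rewrite fineK// ge0_fin_numE// int_pos_ge0// => t _.
exact: sqr_wgt_ge0.
Qed.

Lemma massE : int_pos (fun t => u t ^+ 2 * wgt d t) = B%:E.
Proof.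
case: H => _ _ _ fin; rewrite fineK// ge0_fin_numE// int_pos_ge0// => t _.
exact: sqr_wgt_ge0.
Qed.

Lemma dirichlet_ge0 : 0 <= A.
Proof. by rewrite fine_ge0// int_pos_ge0// => t _; exact: sqr_wgt_ge0. Qed.

Lemma mass_ge0 : 0 <= B.
Proof. by rewrite fine_ge0// int_pos_ge0// => t _; exact: sqr_wgt_ge0. Qed.

Lemma measurable_sqr_wgt (f : R -> R) (D : set R) :
  measurable_fun D f -> measurable_fun D (fun t => f t ^+ 2 * wgt d t).
Proof.
move=> mf; apply: measurable_funM; first exact: measurable_funX.
exact: measurable_powR1D.
Qed.

(** Trades the natural weight for (1 + t)^a at the price of a factor [k]; this is what leaves the
    exponent in the Cauchy-Schwarz bound free. *)
Lemma dirichlet_segment_le a k x y : 0 < x -> 0 <= k ->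
  (forall t, x <= t <= y -> (1 + t) `^ a <= k * wgt d t) ->
  (\int[mu]_(t in `[x, y]) (g t ^+ 2 * (1 + t) `^ a)%:E <= (k * A)%:E)%E.
Proof.
move=> x0 k0 le_ak; rewrite EFinM -dirichletE; case: H => _ mg _ _.
apply: le_int_pos => //.
- exact: segment_pos.
- exact: measurable_sqr_wgt.
- by move=> t _; exact: sqr_wgt_ge0.
- apply: measurable_funM; last exact: measurable_powR1D.
  by apply: measurable_funX; apply: measurable_funS mg => //; exact: segment_pos.
- by move=> t _; rewrite mulr_ge0 ?sqr_ge0 ?powR_ge0.
- move=> t /=; rewrite in_itv/= => /le_ak h.
  by rewrite mulrCA ler_wpM2l// sqr_ge0.
Qed.

Lemma increment_le a k Q x y : 0 < x -> x <= y -> 0 <= k -> 0 <= Q ->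
  (forall t, x <= t <= y -> (1 + t) `^ a <= k * wgt d t) ->
  (\int[mu]_(t in `[x, y]) ((1 + t) `^ (- a))%:E <= Q%:E)%E ->
  (u y - u x) ^+ 2 <= k * A * Q.
Proof.
move=> x0 xy k0 Q0 le_ak hQ; case: (H) => /(_ _ _ x0 xy)[ig ug] _ _ _.
apply: (cauchy_schwarz_increment x0 xy ig ug _ Q0 _ hQ).
- by rewrite mulr_ge0// dirichlet_ge0.
- exact: dirichlet_segment_le.
Qed.

(** The choice a = d - 1 with k = 1; since d >= 1 the weight is nondecreasing, so its inverse on
    [x, y] is at most its value at x. *)
Lemma increment_wgt_le x y : 0 < x -> x <= y ->
  (u y - u x) ^+ 2 <= A * ((y - x) / wgt d x).
Proof.
move=> x0 xy; rewrite -[A]mul1r; apply: (@increment_le (d - 1)) => //.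
- by rewrite divr_ge0 ?wgt_ge0// subr_ge0.
- by move=> t _; rewrite mul1r.
- rewrite mulrC -integral_segment_cst//; apply: ge0_le_integral => //.
  + by move=> t _; rewrite lee_fin powR_ge0.
  + by apply/measurable_EFinP; exact: measurable_powR1D.
  + move=> t /=; rewrite in_itv/= => /andP[xt _]; rewrite lee_fin powRN.
    have t0 : 0 < t := lt_le_trans x0 xt.
    by rewrite lef_pV2 ?posrE ?powR_gt0//; [apply: wgt_homo; lra|lra|lra].
Qed.

Lemma increment_dist_le x y : 0 < x -> 0 < y -> (u y - u x) ^+ 2 <= A * `|y - x|.
Proof.
wlog xy : x y / x <= y => [th|] x0 y0.
  have [|/ltW yx] := leP x y; first by move=> /th; exact.
  by rewrite -sqrrN opprB distrC; exact: th.
apply: le_trans (increment_wgt_le x0 xy) _.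
rewrite ler_wpM2l ?dirichlet_ge0// ger0_norm ?subr_ge0//.
have w1 := wgt_ge1 (ltW x0).
by rewrite ler_pdivrMr ?ler_peMr ?subr_ge0//; lra.
Qed.

(** [H1w] does not state measurability of u. It follows from continuity, because [increment_dist_le]
    makes u Hoelder continuous of order 1/2. *)
Lemma measurable_H1w : measurable_fun (`]0, +oo[ : set R) u.
Proof.
apply: open_continuous_measurable_fun => //.
move=> x; rewrite inE/= in_itv/= andbT => x0.
apply/cvgrPdist_lt => e e0.
have A0 := dirichlet_ge0.
near=> y.
have y0 : 0 < y by near: y; exact: lt_nbhsr.
rewrite -ltr_sqr ?nnegrE ?normr_ge0 ?ltW// real_normK ?num_real//.
apply: le_lt_trans (increment_dist_le y0 x0) _.
(* Dividing by A + 1 rather than by A also covers A = 0. *)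
apply: (@le_lt_trans _ _ (A * (e ^+ 2 / (A + 1)))).
  rewrite ler_wpM2l//; near: y.
  by apply: cvgr_dist_le => //; rewrite divr_gt0 ?exprn_gt0//; lra.
rewrite mulrCA gtr_pMr ?exprn_gt0// ltr_pdivrMr; lra.
Unshelve. all: by end_near. Qed.

(** For s in the window [t, t + h], u(t)^2 is at most 2 u(s)^2 + 2 (u(s) - u(t))^2. After
    multiplication by the weight at t, the first term is controlled by the mass density at s and the
    second by 2 h A; integrate over s and divide by h. Here h is still arbitrary. *)
Lemma wgt_sqr_le h t : 0 < h -> 0 < t ->
  u t ^+ 2 * wgt d t <= 2 * B / h + 2 * h * A.
Proof.
move=> h0 t0; have th : t <= t + h by lra.
suff : ((u t ^+ 2 * wgt d t * h)%:E <= (2 * B + 2 * h * A * h)%:E)%E.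
  rewrite lee_fin -ler_pdivlMr// => /le_trans; apply.
  by rewrite mulrDl mulfK ?gt_eqF.
have A0 := dirichlet_ge0.
have -> : u t ^+ 2 * wgt d t * h = u t ^+ 2 * wgt d t * (t + h - t) by ring.
rewrite -integral_segment_cst//.
have mu2 : measurable_fun (`[t, t + h] : set R) (fun s => u s ^+ 2 * wgt d s).
  apply: measurable_sqr_wgt; apply: measurable_funS measurable_H1w => //.
  exact: segment_pos.
apply: (@le_trans _ _ (\int[mu]_(s in `[t, (t + h)%R])
    ((2 * (u s ^+ 2 * wgt d s))%:E + (2 * h * A)%:E))%E).
  apply: ge0_le_integral => //.
  - by move=> s _; rewrite lee_fin sqr_wgt_ge0.
  - apply: emeasurable_funD => //; apply/measurable_EFinP.
    exact: measurable_funM.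
  - move=> s /=; rewrite in_itv/= => /andP[ts sh]; rewrite -EFinD lee_fin.
    have w0 : 0 < wgt d t by rewrite powR_gt0//; lra.
    have h1 : (u s - u t) ^+ 2 * wgt d t <= A * (s - t).
      by rewrite -ler_pdivlMr// -mulrA; exact: increment_wgt_le.
    have h2 : A * (s - t) <= A * h by rewrite ler_wpM2l//; lra.
    have h3 : u s ^+ 2 * wgt d t <= u s ^+ 2 * wgt d s.
      by rewrite ler_wpM2l ?sqr_ge0// wgt_homo// ltW.
    have : u t ^+ 2 * wgt d t <= 2 * (u s ^+ 2 * wgt d t) + 2 * ((u s - u t) ^+ 2 * wgt d t).
      rewrite !mulrA -mulrDl ler_wpM2r ?wgt_ge0//.
      (* The difference of the two sides is exactly (2 u(s) - u(t))^2. *)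
      have := sqr_ge0 (2 * u s - u t); rewrite !expr2; lra.
    lra.
rewrite ge0_integralD//; last 3 first.
- by move=> s _; rewrite lee_fin mulr_ge0// sqr_wgt_ge0.
- by apply/measurable_EFinP; exact: measurable_funM.
- by move=> s _; rewrite lee_fin !mulr_ge0// ltW.
rewrite integral_segment_cst// EFinD leeD//; last by rewrite lee_fin addrAC subrr add0r.
rewrite EFinM -massE; apply: le_int_pos => //.
- exact: segment_pos.
- by apply: measurable_sqr_wgt; exact: measurable_H1w.
- by move=> s _; exact: sqr_wgt_ge0.
- exact: measurable_funM.
- by move=> s _; rewrite mulr_ge0// sqr_wgt_ge0.
Qed.

End H1w_theory.

(** * Tonelli's theorem on the triangle t <= r *)

Section Triangle.
Context {R : realType}.
Notation mu := (@lebesgue_measure R).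

Variables a b : R -> R.
Hypotheses (ma : measurable_fun setT a) (mb : measurable_fun setT b).
Hypotheses (a0 : forall t, 0 <= a t) (b0 : forall t, 0 <= b t).

(** Extension by zero off the triangle turns the integrals with a moving endpoint into full-line
    integrals of one function on the plane, the form in which Tonelli applies. *)
Let F (z : R * R) : \bar R := (if z.1 <= z.2 then a z.1 * b z.2 else 0)%:E.

Let F0 z : (0 <= F z)%E.
Proof. by rewrite lee_fin; case: ifP => // _; exact: mulr_ge0. Qed.

Let mF : measurable_fun setT F.
Proof.
apply/measurable_EFinP; apply: measurable_fun_ifT.
- exact: measurable_fun_ler.
- by apply: measurable_funM; apply: measurableT_comp.
- exact: measurable_cst.
Qed.

Let FE t : (\int[mu]_(r in `[t, +oo[) (a t * b r)%:E = \int[mu]_r F (t, r))%E.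
Proof.
rewrite integral_mkcond; apply: eq_integral => r _.
by rewrite patchE /F/= mem_setE in_itv/= andbT; case: ifP.
Qed.

Lemma measurable_integral_tail :
  measurable_fun setT (fun t : R => \int[mu]_(r in `[t, +oo[) (a t * b r)%:E)%E.
Proof.
under eq_fun do rewrite FE.
exact: (@measurable_fun_fubini_tonelli_F _ _ _ _ R mu F mF F0).
Qed.

(** After the exchange, the inner integral runs over t <= r and only involves [a], where the bound
    [S] applies. *)
Lemma integral_triangle_le (S : R -> R) : measurable_fun setT S ->
  (forall r, (\int[mu]_(t in `]-oo, r]) (a t)%:E <= (S r)%:E)%E) ->
  (\int[mu]_t \int[mu]_(r in `[t, +oo[) (a t * b r)%:E <=
   \int[mu]_r (S r * b r)%:E)%E.
Proof.
move=> mS aS.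
have -> : (\int[mu]_t \int[mu]_(r in `[t, +oo[) (a t * b r)%:E =
           \int[mu]_t \int[mu]_r F (t, r))%E by apply: eq_integral => t _; exact: FE.
have -> := @fubini_tonelli _ _ _ _ R mu mu F mF F0.
apply: ge0_le_integral => //.
- by move=> r _; exact: integral_ge0.
- exact: (@measurable_fun_fubini_tonelli_G _ _ _ _ R mu F mF F0).
- by apply/measurable_EFinP; exact: measurable_funM.
move=> r _.
have -> : (\int[mu]_t F (t, r) = \int[mu]_(t in `]-oo, r]) ((b r)%:E * (a t)%:E))%E.
  rewrite [RHS]integral_mkcond; apply: eq_integral => t _.
  by rewrite patchE /F/= mem_setE in_itv/=; case: ifP => // _; rewrite mulrC.
rewrite ge0_integralZl//; last 3 first.
- by apply/measurable_EFinP; exact: measurable_funTS.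
- by move=> t _; rewrite lee_fin.
- by rewrite lee_fin.
by rewrite mulrC EFinM lee_wpmul2l ?lee_fin.
Qed.

End Triangle.

(** * Estimates at the scale h *)

Section PowR.
Context {R : realType}.
Implicit Types a b e s h : R.

Lemma powRD_gt0 s a b : 0 < s -> s `^ (a + b) = s `^ a * s `^ b.
Proof. by move=> s0; rewrite powRD// (gt_eqF s0) implybT. Qed.

Lemma le0_ler_powR e h s : e <= 0 -> 0 < h -> h <= s -> s `^ e <= h `^ e.
Proof.
move=> e0 h0 hs; have s0 := lt_le_trans h0 hs.
rewrite -[e]opprK !(powRN _ (- e)) lef_pV2 ?posrE ?powR_gt0//.
by apply: ge0_ler_powR; rewrite ?nnegrE; lra.
Qed.

End PowR.

Section Scale.
Context {R : realType}.
Notation mu := (@lebesgue_measure R).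
Variables (d : R) (u g : R -> R) (h : R).
Hypotheses (d1 : 1 <= d) (H : H1w d u g) (h0 : 0 < h).

Let A : R := fine (int_pos (fun t => g t ^+ 2 * wgt d t)).
Let B : R := fine (int_pos (fun t => u t ^+ 2 * wgt d t)).
Hypothesis BE : B = A * h ^+ 2.

(** With theta = (d - 2 b) / 2 and B = A h^2, this is A^theta B^(1 - theta), the target right side.
    The hypothesis [BE] expresses h = sqrt (B / A) without a division. *)
Let M b : R := A * h `^ (2 - d + 2 * b).

Let A0 : 0 <= A. Proof. exact: dirichlet_ge0. Qed.

(** For this h both terms of [wgt_sqr_le] equal 2 h A. *)
Lemma sqr_wgt_le t : 0 < t -> u t ^+ 2 * wgt d t <= 4 * (h * A).
Proof.
move=> t0; apply: le_trans (wgt_sqr_le d1 H h0 t0) _.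
suff -> : 2 * B / h + 2 * h * A = 4 * (h * A) by [].
by rewrite BE; field; rewrite gt_eqF.
Qed.

Lemma trace_le b t : 0 < t ->
  u t ^+ 2 * (1 + t) `^ (2 * b) <= 4 * (h * A) * (1 + t) `^ (2 * b - (d - 1)).
Proof.
move=> t0; have -> : 2 * b = (d - 1) + (2 * b - (d - 1)) by ring.
rewrite powRD_gt0; last by lra.
by rewrite mulrA addrAC subrr add0r ler_wpM2r ?powR_ge0// sqr_wgt_le.
Qed.

Lemma scaleE b : h * A * h `^ (2 * b - (d - 1)) = M b.
Proof.
rewrite mulrAC mulrC /M; congr (_ * _).
rewrite -{1}[h]powRr1 ?ltW// -powRD_gt0//; congr (_ `^ _); ring.
Qed.

Lemma M_ge0 b : 0 <= M b.
Proof. by rewrite mulr_ge0 ?powR_ge0. Qed.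

(** The exponent 2 b - (d - 1) in [trace_le] is nonpositive, so for 1 + t >= h its power is largest
    at 1 + t = h, where [scaleE] identifies the bound. *)
Lemma far_le b t : 2 * b <= d - 1 -> 0 < t -> h <= 1 + t ->
  u t ^+ 2 * (1 + t) `^ (2 * b) <= 4 * M b.
Proof.
move=> bd t0 ht; apply: le_trans (trace_le b t0) _.
rewrite -scaleE -!mulrA ler_wpM2l// ler_wpM2l ?(ltW h0)// ler_wpM2l//.
by apply: le0_ler_powR => //; lra.
Qed.

(** At 1 + t = h exactly, [trace_le] gives the right scaling whatever the sign of 2 b - (d - 1).
    This is the anchor value for all estimates with 1 + t <= h; the condition 1 < h makes h - 1 a
    point of the half-line. *)
Lemma corner_le b : 1 < h -> u (h - 1) ^+ 2 * h `^ (2 * b) <= 4 * M b.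
Proof.
move=> h1; have := @trace_le b (h - 1); rewrite subr_gt0 => /(_ h1).
by rewrite addrCA subrr addr0 -scaleE -!mulrA.
Qed.

Lemma wgt_dominates a t : d - 1 <= a -> 0 < t -> 1 + t <= h ->
  (1 + t) `^ a <= h `^ (a - (d - 1)) * wgt d t.
Proof.
move=> ad t0 th; rewrite -{1}[a](subrK (d - 1)) powRD_gt0; last by lra.
rewrite ler_wpM2r ?powR_ge0//; apply: ge0_ler_powR; rewrite ?nnegrE; lra.
Qed.

Lemma sqr_le_split x y : x ^+ 2 <= 2 * y ^+ 2 + 2 * (y - x) ^+ 2 :> R.
Proof. by have := sqr_ge0 (2 * y - x); rewrite !expr2; lra. Qed.

Lemma integral_powR1DN a x y : 0 < a -> 0 <= x -> x <= y ->
  (\int[mu]_(r in `[x, y]) ((1 + r) `^ (- (1 + a)))%:E <=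
   ((1 + x) `^ (- a) / a)%:E)%E.
Proof.
move=> a0 x0 xy; have -> : - (1 + a) = - a - 1 by ring.
rewrite integral_powR1D ?oppr_eq0 ?gt_eqF//.
rewrite lee_fin invrN mulrN -mulNr opprB ler_wpM2r ?invr_ge0 ?(ltW a0)//.
by rewrite gerBl powR_ge0.
Qed.

(** With a = 1 + 2 b the integral of s^(-a) from t onwards is at most (1 + t)^(-2 b) / (2 b), which
    the weight (1 + t)^(2 b) cancels. The condition d - 2 <= 2 b says a >= d - 1, so s^a is
    dominated by the natural weight up to a power of h. The constant is 2 * 4 from the anchor plus 2
    / (2 b) from the increment. *)
Lemma near_le b t : 0 < b -> d - 2 <= 2 * b -> 0 < t -> 1 + t <= h ->
  u t ^+ 2 * (1 + t) `^ (2 * b) <= (8 + b^-1) * M b.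
Proof.
move=> b0 db t0 th; have h1 : 1 < h by lra.
have inc : (u (h - 1) - u t) ^+ 2 <=
    h `^ (1 + 2 * b - (d - 1)) * A * ((1 + t) `^ (- (2 * b)) / (2 * b)).
  apply: (increment_le H (a := 1 + 2 * b)) => //.
  - by lra.
  - exact: powR_ge0.
  - by rewrite divr_ge0 ?powR_ge0//; lra.
  - by move=> r /andP[tr rh]; apply: wgt_dominates; lra.
  - by apply: integral_powR1DN; lra.
have s0 : 0 < (1 + t) `^ (2 * b) by rewrite powR_gt0//; lra.
have sh : (1 + t) `^ (2 * b) <= h `^ (2 * b).
  by apply: ge0_ler_powR; rewrite ?nnegrE; lra.
have k : h `^ (1 + 2 * b - (d - 1)) * A = M b.
  by rewrite mulrC /M; congr (_ * _ `^ _); ring.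
rewrite k powRN in inc.
have inc' : (u (h - 1) - u t) ^+ 2 * (1 + t) `^ (2 * b) <= M b / (2 * b).
  rewrite -ler_pdivlMr//; apply: le_trans inc _.
  by rewrite mulrCA mulrC.
apply: le_trans (ler_wpM2r (ltW s0) (sqr_le_split _ (u (h - 1)))) _.
have c := corner_le b h1.
have c' : u (h - 1) ^+ 2 * (1 + t) `^ (2 * b) <= 4 * M b.
  by apply: le_trans c; rewrite ler_wpM2l ?sqr_ge0.
have -> : (8 + b^-1) * M b = 2 * (4 * M b) + 2 * (M b / (2 * b)).
  by field; rewrite gt_eqF.
rewrite mulrDl -[2 * _ * _]mulrA -[2 * (_ - _) ^+ 2 * _]mulrA.
by apply: lerD; rewrite ler_wpM2l.
Qed.

Lemma sup_le b t : 0 < b -> d - 2 <= 2 * b -> 2 * b <= d - 1 -> 0 < t ->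
  u t ^+ 2 * (1 + t) `^ (2 * b) <= (8 + b^-1) * M b.
Proof.
move=> b0 db bd t0; have [th|/ltW ht] := leP (1 + t) h; first exact: near_le.
apply: le_trans (far_le bd t0 ht) _; rewrite ler_wpM2r ?M_ge0//.
have : 0 < b^-1 by rewrite invr_gt0.
lra.
Qed.

(** At b = 0 the exponent 1 + 2 b would produce a logarithm. With a = d - 1 instead, the integral of
    s^(-a) up to s = h is at most h^(2 - d) / (2 - d), which uses d < 2. *)
Lemma sup_le0 t : d < 2 -> 0 < t -> u t ^+ 2 <= (8 + 2 / (2 - d)) * M 0.
Proof.
move=> d2 t0; have d20 : 0 < (2 - d)^-1 by rewrite invr_gt0; lra.
have [th|/ltW ht] := leP (1 + t) h; last first.
  have := @far_le 0 t; rewrite mulr0 powRr0 mulr1 => /(_ _ t0 ht) far.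
  have d10 : 0 <= d - 1 by have := d1; lra.
  apply: le_trans (far d10) _.
  by rewrite ler_wpM2r ?M_ge0//; lra.
have h1 : 1 < h by lra.
have inc : (u (h - 1) - u t) ^+ 2 <= 1 * A * (h `^ (2 - d) / (2 - d)).
  apply: (increment_le H (a := d - 1)) => //.
  - by lra.
  - by rewrite mulr_ge0 ?powR_ge0 ?(ltW d20).
  - by move=> r _; rewrite mul1r.
  - have -> : - (d - 1) = (2 - d) - 1 by ring.
    rewrite integral_powR1D; [|lra..].
    rewrite lee_fin ler_wpM2r ?(ltW d20)// addrCA subrr addr0.
    by rewrite gerBl powR_ge0.
have c := @corner_le 0 h1; rewrite mulr0 powRr0 mulr1 in c.
apply: le_trans (sqr_le_split _ (u (h - 1))) _.
have -> : (8 + 2 / (2 - d)) * M 0 = 2 * (4 * M 0) + 2 * (1 * A * (h `^ (2 - d) / (2 - d))).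
  by rewrite /M mulr0 addr0; ring.
by apply: lerD; rewrite ler_wpM2l.
Qed.

End Scale.

(** * The weighted mass, by a Hardy-type argument *)

Section WeightedMass.
Context {R : realType}.
Notation mu := (@lebesgue_measure R).
Variables (d : R) (u g : R -> R) (h : R).
Hypotheses (d1 : 1 <= d) (H : H1w d u g) (h0 : 0 < h).

Let A : R := fine (int_pos (fun t => g t ^+ 2 * wgt d t)).
Let B : R := fine (int_pos (fun t => u t ^+ 2 * wgt d t)).
Hypothesis BE : B = A * h ^+ 2.

Let M b : R := A * h `^ (2 - d + 2 * b).

Let A0 : 0 <= A. Proof. exact: dirichlet_ge0. Qed.

Let D : set R := `]0, h - 1].

Let D_pos : D `<=` `]0, +oo[.
Proof. by move=> t; rewrite /D/= !in_itv/= andbT => /andP[]. Qed.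

Let mD : measurable D. Proof. exact: measurable_itv. Qed.

Section Near.
Variable b : R.
Hypotheses (b0 : 0 < b) (db : d - 2 <= 2 * b).

(** The increment bound with a = 1 + b yields (1 + t)^(-b) / b times an integral of g^2 s^(1 + b)
    over [t, h - 1]. Multiplied by (1 + t)^(2 b - 1), the factor in t is (1 + t)^(b - 1) / b.
    [hardy_l] and [hardy_r] are the factors in t and in r, extended by zero. *)
Let hardy_l : R -> R := (fun t => (1 + t) `^ (b - 1)) \_ `]0, +oo[.
Let hardy_r : R -> R := (fun r => g r ^+ 2 * (1 + r) `^ (1 + b)) \_ D.

Let hardy_l_ge0 t : 0 <= hardy_l t.
Proof. by rewrite /hardy_l patchE; case: ifP => // _; exact: powR_ge0. Qed.

Let hardy_r_ge0 t : 0 <= hardy_r t.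
Proof.
by rewrite /hardy_r patchE; case: ifP => // _; rewrite mulr_ge0 ?sqr_ge0 ?powR_ge0.
Qed.

Let measurable_g (E : set R) (a : R) : measurable E -> E `<=` `]0, +oo[ ->
  measurable_fun E (fun t => g t ^+ 2 * (1 + t) `^ a).
Proof.
move=> mE E0; apply: measurable_funM; last exact: measurable_powR1D.
by case: H => _ mg _ _; apply: measurable_funX; apply: measurable_funS mg.
Qed.

Let measurable_hardy_l : measurable_fun setT hardy_l.
Proof.
by apply/(measurable_restrictT _ (measurable_itv _)); exact: measurable_powR1D.
Qed.

Let measurable_hardy_r : measurable_fun setT hardy_r.
Proof. by apply/(measurable_restrictT _ (measurable_itv _)); exact: measurable_g. Qed.

(** Integrating first in t gives at most (1 + r)^b / b, which raises the exponent on g^2 to 1 + 2 b.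
    For 1 + r <= h this is dominated by the natural weight, because d - 2 <= 2 b. *)
Lemma hardy_le : (\int[mu]_t \int[mu]_(r in `[t, +oo[) (hardy_l t * hardy_r r)%:E
  <= (b^-1 * M b)%:E)%E.
Proof.
apply: (@le_trans _ _ (\int[mu]_r ((1 + r) `^ b / b * hardy_r r)%:E)%E).
  apply: integral_triangle_le => //.
    by apply: measurable_funM => //; exact: measurable_powR1D.
  move=> r; have -> : (\int[mu]_(t in `]-oo, r]) (hardy_l t)%:E =
      \int[mu]_(t in `]-oo, r] `&` `]0%R, +oo[) ((1 + t) `^ (b - 1))%:E)%E.
    rewrite integral_mkcondr; apply: eq_integral => t _.
    by rewrite !patchE /hardy_l patchE; case: ifP.
  have [r0|/ltW r0] := leP r 0.
    have -> : (`]-oo, r] `&` `]0, +oo[ : set R) = set0.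
      apply/seteqP; split=> // t [] /=; rewrite !in_itv/= andbT => tr t0.
      by have := lt_le_trans t0 (le_trans tr r0); rewrite ltxx.
    by rewrite integral_set0 lee_fin divr_ge0 ?powR_ge0 ?ltW.
  apply: (@le_trans _ _ (\int[mu]_(t in `[0%R, r]) ((1 + t) `^ (b - 1))%:E)%E).
    apply: ge0_subset_integral => //.
    - exact: measurableI.
    - by apply/measurable_EFinP; exact: measurable_powR1D.
    - by move=> t _; rewrite lee_fin powR_ge0.
    - by move=> t [] /=; rewrite !in_itv/= andbT => -> /ltW ->.
  rewrite integral_powR1D ?gt_eqF// lee_fin addr0.
  by rewrite ler_wpM2r ?invr_ge0 ?(ltW b0)// gerBl powR_ge0.
have -> : (\int[mu]_r ((1 + r) `^ b / b * hardy_r r)%:E =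
    \int[mu]_(r in D) (b^-1 * (g r ^+ 2 * (1 + r) `^ (1 + 2 * b)))%:E)%E.
  rewrite [RHS]integral_mkcond; apply: eq_integral => r _.
  rewrite /hardy_r !patchE; case: ifPn => [|_]; last by rewrite mulr0.
  rewrite inE => /D_pos/=; rewrite in_itv/= andbT => r0; congr EFin.
  have -> : 1 + 2 * b = b + (1 + b) by ring.
  by rewrite (powRD_gt0 b); [ring|lra].
have -> : b^-1 * M b = b^-1 * h `^ (1 + 2 * b - (d - 1)) * A.
  rewrite /M -mulrA [_ * A]mulrC; congr (_ * (_ * _ `^ _)); ring.
rewrite EFinM -(dirichletE H); apply: (le_int_pos mD D_pos) => //.
- by apply: measurable_sqr_wgt; case: H.
- by move=> t _; exact: sqr_wgt_ge0.
- by apply: measurable_funM => //; exact: measurable_g.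
- by move=> t _; rewrite mulr_ge0 ?invr_ge0 ?(ltW b0)// mulr_ge0 ?sqr_ge0 ?powR_ge0.
- by rewrite mulr_ge0 ?powR_ge0 ?invr_ge0 ?(ltW b0).
- move=> t; rewrite /D/= in_itv/= => /andP[t0 th].
  rewrite -[leRHS]mulrA; apply: ler_wpM2l; first by rewrite invr_ge0 ltW.
  rewrite [leRHS]mulrCA; apply: ler_wpM2l; first exact: sqr_ge0.
  by apply: wgt_dominates => //; have := db; lra.
Qed.

(** Split u(t) into its value at h - 1 and the increment. The first part contributes 4 / b through
    [corner_le], the second 2 / b^2 through [hardy_le]. Using a = 1 + 2 b pointwise would leave the
    integral of 1 / s and lose a logarithm; a = 1 + b keeps the integral in r inside, to be
    exchanged with the one in t. *)
Lemma near_mass_le : (\int[mu]_(t in D) (u t ^+ 2 * (1 + t) `^ (2 * b - 1))%:E <=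
  ((4 / b + 2 / b ^+ 2) * M b)%:E)%E.
Proof.
have M0 : 0 <= M b by rewrite mulr_ge0 ?powR_ge0.
have b2 : 0 < b^-1 by rewrite invr_gt0.
have [h1|h1] := leP h 1.
  rewrite (_ : D = set0).
    by rewrite integral_set0 lee_fin mulr_ge0// addr_ge0// divr_ge0// ?exprn_ge0// ltW.
  apply/seteqP; split=> // t; rewrite /D/= in_itv/= => /andP[t0 th].
  by have := lt_le_trans t0 th; rewrite subr_gt0 ltNge h1.
set c := 2 * u (h - 1) ^+ 2.
pose T t := (\int[mu]_(r in `[t, +oo[) (hardy_l t * hardy_r r)%:E)%E.
have T0 t : (0 <= T t)%E by apply: integral_ge0 => r _; rewrite lee_fin mulr_ge0.
have mT : measurable_fun setT T by exact: measurable_integral_tail.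
have c0 : 0 <= c by rewrite mulr_ge0 ?sqr_ge0.
have ptw t : D t -> ((u t ^+ 2 * (1 + t) `^ (2 * b - 1))%:E <=
    c%:E * ((1 + t) `^ (2 * b - 1))%:E + (2 / b)%:E * T t)%E.
  rewrite /D/= in_itv/= => /andP[t0 th].
  have TE : (T t = ((1 + t) `^ (b - 1))%:E *
      \int[mu]_(r in `[t, (h - 1)%R]) (g r ^+ 2 * (1 + r) `^ (1 + b))%:E)%E.
    have -> : (`[t, h - 1]%classic : set R) = `[t, +oo[%classic `&` D.
      apply/seteqP; split=> r; rewrite /D/= !in_itv/= andbT.
        by move=> /andP[tr rh]; rewrite tr rh (lt_le_trans t0).
      by move=> [-> /andP[_ ->]].
    rewrite integral_mkcondr -ge0_integralZl//.
    - apply: eq_integral => r _; rewrite patchE /hardy_l /hardy_r !patchE.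
      have -> : t \in (`]0, +oo[%classic : set R) by rewrite inE/= in_itv/= t0.
      by case: ifP => _; rewrite ?mulr0 ?mule0.
    - apply: measurable_funTS; apply/(measurable_restrictT _ (measurable_itv _)).
      by apply/measurable_EFinP; exact: measurable_g.
    - by move=> r _; rewrite patchE; case: ifP => // _; rewrite lee_fin mulr_ge0 ?sqr_ge0 ?powR_ge0.
    - by rewrite lee_fin powR_ge0.
  (* A crude domination, used only to see that the inner integral is finite and can be replaced by a
     real number G. *)
  have dom r : t <= r <= h - 1 -> (1 + r) `^ (1 + b) <= h `^ (1 + b) * wgt d r.
    move=> /andP[tr rh]; rewrite -[leLHS]mulr1 ler_pM ?powR_ge0//; last first.
      by apply: wgt_ge1 => //; lra.
    by apply: ge0_ler_powR; rewrite ?nnegrE; have := b0; lra.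
  have fin := dirichlet_segment_le H t0 (powR_ge0 _ _) dom.
  have G0 : (0 <= \int[mu]_(r in `[t, (h - 1)%R]) (g r ^+ 2 * (1 + r) `^ (1 + b))%:E)%E.
    by apply: integral_ge0 => r _; rewrite lee_fin mulr_ge0 ?sqr_ge0 ?powR_ge0.
  have Gfin : (\int[mu]_(r in `[t, (h - 1)%R]) (g r ^+ 2 * (1 + r) `^ (1 + b))%:E)%E \is a fin_num.
    by rewrite ge0_fin_numE// (le_lt_trans fin)// ltry.
  have := fineK Gfin; set G := fine _ => GE; rewrite -GE in TE.
  case: (H) => /(_ _ _ t0 th)[ig ug] _ _ _.
  have s0 : 0 < 1 + t by lra.
  have inc := @cauchy_schwarz_increment _ u g (1 + b) t (h - 1) G ((1 + t) `^ (- b) / b)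
    t0 th ig ug (fine_ge0 G0).
  have {}inc : (u (h - 1) - u t) ^+ 2 <= G * ((1 + t) `^ (- b) / b).
    apply: inc; rewrite ?GE//.
    - by rewrite divr_ge0 ?powR_ge0// ltW.
    - by apply: integral_powR1DN => //; exact: ltW.
  rewrite TE -!EFinM -EFinD lee_fin.
  apply: le_trans (ler_wpM2r (powR_ge0 _ _) (sqr_le_split _ (u (h - 1)))) _.
  rewrite mulrDl lerD//.
  have -> : 2 / b * ((1 + t) `^ (b - 1) * G) =
            2 * (G * ((1 + t) `^ (- b) / b)) * (1 + t) `^ (2 * b - 1).
    have -> : b - 1 = - b + (2 * b - 1) by ring.
    by rewrite powRD_gt0//; ring.
  by rewrite ler_wpM2r ?powR_ge0// ler_wpM2l.
have msum : measurable_fun D (fun t => c%:E * ((1 + t) `^ (2 * b - 1))%:E)%E.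
  by apply: emeasurable_funM => //; apply/measurable_EFinP; exact: measurable_powR1D.
have mT' : measurable_fun D (fun t => (2 / b)%:E * T t)%E.
  by apply: emeasurable_funM => //; exact: measurable_funTS.
have b20 : (0 <= (2 / b)%:E)%E by rewrite lee_fin mulr_ge0// ltW.
apply: (@le_trans _ _ (\int[mu]_(t in D)
    (c%:E * ((1 + t) `^ (2 * b - 1))%:E + (2 / b)%:E * T t))%E).
  apply: ge0_le_integral => //.
  - by move=> t _; rewrite lee_fin mulr_ge0 ?sqr_ge0 ?powR_ge0.
  - apply/measurable_EFinP; apply: measurable_funM; last exact: measurable_powR1D.
    by apply: measurable_funX; apply: measurable_funS (measurable_H1w d1 H).
  - exact: emeasurable_funD.
rewrite ge0_integralD//; last 2 first.
- by move=> t _; rewrite mule_ge0 ?lee_fin ?powR_ge0.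
- by move=> t _; rewrite mule_ge0.
rewrite !ge0_integralZl//; last 3 first.
- exact: measurable_funTS.
- by apply/measurable_EFinP; exact: measurable_powR1D.
- by move=> t _; rewrite lee_fin powR_ge0.
(* The target is split as anchor part, slack and increment part; the slack is nonnegative by
   [corner_le]. *)
have -> : ((4 / b + 2 / b ^+ 2) * M b)%:E =
    (c%:E * (h `^ (2 * b) / (2 * b))%:E + ((4 / b) * M b - c * (h `^ (2 * b) / (2 * b)))%:E
     + (2 / b)%:E * (b^-1 * M b)%:E)%E.
  by rewrite -!EFinM -!EFinD; congr EFin; field; rewrite gt_eqF.
apply: leeD; last first.
  rewrite lee_wpmul2l//; apply: le_trans hardy_le.
  exact: ge0_subset_integral.
rewrite -[leLHS]adde0; apply: leeD; last first.
  rewrite lee_fin subr_ge0.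
  have := corner_le d1 H h0 BE b h1; rewrite -/A -/(M b) => cor.
  rewrite mulrA ler_pdivrMr; last by rewrite mulr_gt0.
  have -> : 4 / b * M b * (2 * b) = 2 * (4 * M b) by field; rewrite gt_eqF.
  by rewrite /c -mulrA ler_wpM2l.
rewrite lee_wpmul2l ?lee_fin//.
apply: (@le_trans _ _ (\int[mu]_(t in `[0%R, (h - 1)%R]) ((1 + t) `^ (2 * b - 1))%:E)%E).
  apply: ge0_subset_integral => //.
  - by apply/measurable_EFinP; exact: measurable_powR1D.
  - by move=> t _; rewrite lee_fin powR_ge0.
  - by move=> t; rewrite /D/= !in_itv/= => /andP[/ltW -> ->].
have bb : 0 < 2 * b by rewrite mulr_gt0.
rewrite integral_powR1D ?gt_eqF//; last by lra.
rewrite lee_fin addrCA subrr addr0 ler_wpM2r ?invr_ge0 ?(ltW bb)//.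
by rewrite gerBl powR_ge0.
Qed.

(** Beyond D one has s > h, and 2 b <= d gives s^(2 b - 1) <= h^(2 b - d) s^(d - 1). That region
    contributes at most h^(2 b - d) B = M b, the summand 1 of the constant. *)
Lemma mass_le : 2 * b <= d ->
  (int_pos (fun t => (u t ^+ 2 * (1 + t) `^ (2 * b - 1))%R) <=
   ((1 + 4 / b + 2 / b ^+ 2) * M b)%:E)%E.
Proof.
move=> bd.
pose f t := u t ^+ 2 * (1 + t) `^ (2 * b - 1).
have f0 t : 0 <= f t by rewrite mulr_ge0 ?sqr_ge0 ?powR_ge0.
have mf : measurable_fun (`]0, +oo[ : set R) f.
  apply: measurable_funM; last exact: measurable_powR1D.
  by apply: measurable_funX; exact: measurable_H1w d1 H.
have mw : measurable_fun (`]0, +oo[ : set R) (fun t => u t ^+ 2 * wgt d t).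
  by apply: measurable_sqr_wgt; exact: measurable_H1w d1 H.
have mfD : measurable_fun (`]0, +oo[ : set R) (f \_ D).
  apply: measurable_funTS; apply/(measurable_restrictT _ (measurable_itv _)).
  exact: measurable_funS mf.
have fD0 t : 0 <= (f \_ D) t by rewrite patchE; case: ifP.
(* One majorant on the whole half-line: the near part cut off to D, plus the far bound taken
   everywhere. *)
apply: (@le_trans _ _ (\int[mu]_(t in `]0%R, +oo[)
    (((f \_ D) t)%:E + (h `^ (2 * b - d))%:E * (u t ^+ 2 * wgt d t)%:E))%E).
  apply: ge0_le_integral => //.
  - by move=> t _; rewrite lee_fin f0.
  - exact/measurable_EFinP.
  - apply: emeasurable_funD; first exact/measurable_EFinP.
    by apply: emeasurable_funM => //; exact/measurable_EFinP.
  move=> t /=; rewrite in_itv/= andbT => t0.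
  rewrite -EFinM -EFinD lee_fin patchE.
  case: ifPn => [_|]; first by rewrite lerDl mulr_ge0 ?powR_ge0 ?sqr_wgt_ge0.
  rewrite add0r notin_setE /D/= in_itv/= t0/= => /negP; rewrite -ltNge => ht.
  have -> : 2 * b - 1 = (d - 1) + (2 * b - d) by ring.
  rewrite powRD_gt0; last by lra.
  rewrite mulrA [leRHS]mulrC ler_wpM2l ?sqr_wgt_ge0//.
  by apply: le0_ler_powR => //; lra.
rewrite ge0_integralD//; last 4 first.
- by move=> t _; rewrite lee_fin.
- exact/measurable_EFinP.
- by move=> t _; rewrite mule_ge0 ?lee_fin ?powR_ge0 ?sqr_wgt_ge0.
- by apply: emeasurable_funM => //; exact/measurable_EFinP.
rewrite ge0_integralZl//; last 3 first.
- exact/measurable_EFinP.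
- by move=> t _; rewrite lee_fin sqr_wgt_ge0.
- by rewrite lee_fin powR_ge0.
have := massE H; rewrite /int_pos => ->; rewrite -/B BE.
have -> : (1 + 4 / b + 2 / b ^+ 2) * M b =
   (4 / b + 2 / b ^+ 2) * M b + h `^ (2 * b - d) * (A * h ^+ 2).
  have -> : h `^ (2 * b - d) * (A * h ^+ 2) = M b.
    rewrite mulrCA /M; congr (_ * _); rewrite -powR_mulrn ?ltW// -powRD_gt0//.
    by congr (_ `^ _); ring.
  ring.
rewrite EFinD -EFinM leeD//.
have -> : (\int[mu]_(t in `]0%R, +oo[) ((f \_ D) t)%:E = \int[mu]_(t in D) (f t)%:E)%E.
  rewrite -[in RHS](setIidr D_pos) integral_mkcondr; apply: eq_integral => t _.
  by rewrite !patchE; case: ifP.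
exact: near_mass_le.
Qed.

End Near.
End WeightedMass.

(** * The inequality *)

Section Assembly.
Context {R : realType}.
Notation mu := (@lebesgue_measure R).
Implicit Types (d b r p h t : R) (u g f k : R -> R).

Lemma int_pos_leD k f1 f2 (c1 c2 : R) :
  measurable_fun (`]0, +oo[ : set R) k ->
  measurable_fun (`]0, +oo[ : set R) f1 -> measurable_fun (`]0, +oo[ : set R) f2 ->
  (forall t, 0 < t -> 0 <= k t) ->
  (forall t, 0 < t -> 0 <= f1 t) -> (forall t, 0 < t -> 0 <= f2 t) ->
  0 <= c1 -> 0 <= c2 -> (forall t, 0 < t -> k t <= c1 * f1 t + c2 * f2 t) ->
  (int_pos k <= c1%:E * int_pos f1 + c2%:E * int_pos f2)%E.
Proof.
have pos t : (`]0, +oo[%classic : set R) t -> 0 < t by rewrite /= in_itv/= andbT.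
move=> mk m1 m2 k0 f10 f20 c10 c20 kf; rewrite /int_pos.
have mc c f : measurable_fun (`]0, +oo[ : set R) f ->
    measurable_fun (`]0, +oo[ : set R) (fun t => c%:E * (f t)%:E)%E.
  by move=> mf; apply: emeasurable_funM => //; exact/measurable_EFinP.
have c0 c f : 0 <= c -> (forall t, 0 < t -> 0 <= f t) ->
    forall t, (`]0, +oo[%classic : set R) t -> (0 <= c%:E * (f t)%:E)%E.
  by move=> ? f0 t /pos t0; rewrite mule_ge0// lee_fin f0.
rewrite -!ge0_integralZl//; try exact/measurable_EFinP;
  try by move=> t /pos t0; rewrite lee_fin ?f10 ?f20.
rewrite -ge0_integralD//; [|exact: c0|exact: mc|exact: c0|exact: mc].
apply: ge0_le_integral => //.
- by move=> t /pos t0; rewrite lee_fin k0.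
- exact/measurable_EFinP.
- by apply: emeasurable_funD; exact: mc.
- by move=> t /pos t0; rewrite -!EFinM -EFinD lee_fin kf.
Qed.

(** In [wgt_sqr_le], one of the two terms vanishes and the other is made smaller than the left side
    by taking h large (A = 0) or small (B = 0); the values of h below make this explicit. *)
Lemma H1w_eq0 d u g t : 1 <= d -> H1w d u g ->
  fine (int_pos (fun t => g t ^+ 2 * wgt d t)) = 0 \/
  fine (int_pos (fun t => u t ^+ 2 * wgt d t)) = 0 -> 0 < t -> u t = 0.
Proof.
move=> d1 H AB t0; have w0 : 0 < wgt d t by rewrite powR_gt0//; lra.
have A0 := dirichlet_ge0 d g; have B0 := mass_ge0 d u.
have H' h (h0 : 0 < h) := wgt_sqr_le d1 H h0 t0.
have [/eqP|x0] := eqVneq (u t ^+ 2 * wgt d t) 0.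
  by rewrite mulf_eq0 (gt_eqF w0) orbF sqrf_eq0 => /eqP.
have : 0 < u t ^+ 2 * wgt d t by rewrite lt_neqAle eq_sym x0 sqr_wgt_ge0.
move: A0 B0 AB H' {x0}; set x := u t ^+ 2 * wgt d t.
set A := fine _; set B := fine _ => A0 B0 AB H' x0.
case: AB => [A00|B00]; exfalso.
- have h0 : 0 < (2 * B + 1) / x by rewrite divr_gt0//; lra.
  have := H' _ h0; rewrite A00 mulr0 addr0 invf_div mulrA ler_pdivlMr; last by lra.
  by nra.
- have h0 : 0 < x / (2 * A + 1) by rewrite divr_gt0//; lra.
  have := H' _ h0; rewrite B00 mulr0 mul0r add0r.
  rewrite mulrA mulrAC ler_pdivlMr; last by lra.
  by nra.
Qed.

Lemma lhs_eq0 b (q : \bar R) u : (2%:E <= q)%E -> (forall t, 0 < t -> u t = 0) ->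
  lhs b q u = 0%E.
Proof.
case: q => [r||]//=; last first.
  move=> _ u0; apply/eqP; rewrite eq_le; apply/andP; split.
    apply: ge_ereal_sup => x [t]; rewrite /= in_itv/= andbT => t0 <- {x}.
    by rewrite u0// normr0 expr0n mul0r.
  apply: ereal_sup_ubound; exists 1; rewrite /= ?in_itv/= ?ltr01//.
  by rewrite u0// normr0 expr0n mul0r.
rewrite lee_fin => r2 u0; rewrite /int_pos (eq_integral (fun=> 0%E)).
  by rewrite integral0 poweR0r// gt_eqF// divr_gt0//; lra.
move=> t; rewrite inE/= in_itv/= andbT => t0.
by rewrite u0// normr0 powR0 ?mul0r// gt_eqF//; lra.
Qed.

(** Reduces the inequality to its form at the scale h = sqrt (B / A). If A or B vanishes there is no
    such scale, but then u = 0 and the left side is zero. *)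
Lemma Star_of_scale d b (q : \bar R) (K : R) : 1 <= d -> (2%:E <= q)%E -> 0 <= K ->
  (forall u g h, H1w d u g -> 0 < h ->
    let A := fine (int_pos (fun t => g t ^+ 2 * wgt d t)) in
    0 < A -> fine (int_pos (fun t => u t ^+ 2 * wgt d t)) = A * h ^+ 2 ->
    (lhs b q u <= (K * (A * h `^ (2 - d + 2 * b)))%:E)%E) ->
  Star d b q.
Proof.
move=> d1 q2 K0 scale; exists K => u g H.
have := dirichlet_ge0 d g; have := mass_ge0 d u.
move: (scale u g) (@H1w_eq0 d u g) => {}scale.
set A := fine _ in scale *; set B := fine _ in scale * => eq0 B0 A0.
have rhs0 : 0 <= K * A `^ ((d - 2 * b) / 2) * B `^ (1 - (d - 2 * b) / 2).
  by rewrite !mulr_ge0 ?powR_ge0.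
have [A00|An0] := eqVneq A 0.
  by rewrite lhs_eq0// => t; apply: eq0 => //; left.
have [B00|Bn0] := eqVneq B 0.
  by rewrite lhs_eq0// => t; apply: eq0 => //; right.
have Ap : 0 < A by rewrite lt_neqAle eq_sym An0.
have Bp : 0 < B by rewrite lt_neqAle eq_sym Bn0.
pose h := Num.sqrt (B / A).
have h0 : 0 < h by rewrite sqrtr_gt0 divr_gt0.
have BE : B = A * h ^+ 2.
  by rewrite sqr_sqrtr ?divr_ge0// mulrCA divff ?mulr1.
apply: le_trans (scale h H h0 Ap BE) _.
rewrite lee_fin -mulrA ler_wpM2l//.
have -> : B `^ (1 - (d - 2 * b) / 2) =
          A `^ (1 - (d - 2 * b) / 2) * h `^ (2 - d + 2 * b).
  rewrite BE powRM ?sqr_ge0//; congr (_ * _).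
  by rewrite -powR_mulrn ?ltW// -powRrM; congr (_ `^ _); field.
rewrite mulrA -powRD_gt0//.
have -> : (d - 2 * b) / 2 + (1 - (d - 2 * b) / 2) = 1 by ring.
by rewrite powRr1.
Qed.

Lemma lhs_le b r u (C M : R) : 0 < r -> 0 <= C -> 0 <= M ->
  (int_pos (fun t => (`|u t| `^ r * (1 + t) `^ (b * r - 1))%R) <= (C * M `^ (r / 2))%:E)%E ->
  (lhs b r%:E u <= (C `^ (2 / r) * M)%:E)%E.
Proof.
move=> r0 C0 M0 I; rewrite /lhs.
have I0 : (0 <= int_pos (fun t => (`|u t| `^ r * (1 + t) `^ (b * r - 1))%R))%E.
  by apply: int_pos_ge0 => t _; rewrite mulr_ge0 ?powR_ge0.
have -> : C `^ (2 / r) * M = (C * M `^ (r / 2)) `^ (2 / r).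
  rewrite powRM ?powR_ge0// -powRrM; congr (_ * _).
  have -> : r / 2 * (2 / r) = 1 by field; rewrite gt_eqF.
  by rewrite powRr1.
rewrite -poweR_EFin; apply: gt0_ler_poweR => //.
- by rewrite divr_ge0// ltW.
- by rewrite in_itv/= I0 leey.
- by rewrite in_itv/= leey lee_fin mulr_ge0 ?powR_ge0.
Qed.

(** For every exponent r the integrand is a power of the single quantity u^2 s^(2 b) against the
    measure dt / s. *)
Lemma integrandE b r u t : 0 < t -> 0 < r ->
  `|u t| `^ r * (1 + t) `^ (b * r - 1) =
  (u t ^+ 2 * (1 + t) `^ (2 * b)) `^ (r / 2) / (1 + t).
Proof.
move=> t0 r0; have s0 : 0 < 1 + t by lra.
rewrite powRM ?sqr_ge0 ?powR_ge0// -powRrM -[u t ^+ 2]real_normK ?num_real//.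
rewrite -powR_mulrn// -powRrM -mulrA; congr (_ `^ _ * _); first by field.
by rewrite powRD_gt0// powR_inv1 ?ltW//; congr (_ `^ _ * _); field.
Qed.

Lemma measurable_integrand b r u : measurable_fun (`]0, +oo[ : set R) u ->
  measurable_fun (`]0, +oo[ : set R) (fun t => `|u t| `^ r * (1 + t) `^ (b * r - 1)).
Proof.
move=> meas_u; apply: measurable_funM; last exact: measurable_powR1D.
by apply: (measurableT_comp (measurable_powR r)); exact: measurableT_comp.
Qed.

Lemma massE_pow b u t : 0 < t ->
  u t ^+ 2 * (1 + t) `^ (2 * b - 1) = u t ^+ 2 * (1 + t) `^ (2 * b) / (1 + t).
Proof.
by move=> t0; rewrite powRD_gt0 ?powR_inv1 ?mulrA//; lra.
Qed.

Lemma measurable_mass b u : measurable_fun (`]0, +oo[ : set R) u ->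
  measurable_fun (`]0, +oo[ : set R) (fun t => u t ^+ 2 * (1 + t) `^ (2 * b - 1)).
Proof.
move=> meas_u; apply: measurable_funM; last exact: measurable_powR1D.
exact: measurable_funX.
Qed.

Lemma int_pos_le_sup b r u (C C' M : R) : 2 <= r -> 0 < M -> 0 <= C -> 0 <= C' ->
  measurable_fun (`]0, +oo[ : set R) u ->
  (forall t, 0 < t -> u t ^+ 2 * (1 + t) `^ (2 * b) <= C * M) ->
  (int_pos (fun t => (u t ^+ 2 * (1 + t) `^ (2 * b - 1))%R) <= (C' * M)%:E)%E ->
  (int_pos (fun t => (`|u t| `^ r * (1 + t) `^ (b * r - 1))%R) <=
    (C `^ (r / 2 - 1) * C' * M `^ (r / 2))%:E)%E.
Proof.
move=> r2 M0 C0 C'0 meas_u sup mass.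
set c := (C * M) `^ (r / 2 - 1).
apply: (@le_trans _ _ (c%:E * int_pos (fun t => (u t ^+ 2 * (1 + t) `^ (2 * b - 1))%R))%E).
  apply: le_int_pos => //.
  - exact: measurable_mass.
  - by move=> t _; rewrite mulr_ge0 ?sqr_ge0 ?powR_ge0.
  - exact: measurable_integrand.
  - by move=> t _; rewrite mulr_ge0 ?powR_ge0.
  - exact: powR_ge0.
  - move=> t; rewrite /= in_itv/= andbT => t0; rewrite integrandE//; last lra.
    have Y0 : 0 <= u t ^+ 2 * (1 + t) `^ (2 * b) by rewrite mulr_ge0 ?sqr_ge0 ?powR_ge0.
    rewrite massE_pow// mulrA; apply: ler_wpM2r; first by rewrite invr_ge0; lra.
    rewrite -[leLHS](@mulr_powRB1 _ _ (r / 2))//; last lra.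
    rewrite mulrC; apply: ler_wpM2r => //; have CM0 : 0 <= C * M by rewrite mulr_ge0// ltW.
    by apply: ge0_ler_powR; rewrite ?nnegrE ?sup//; lra.
apply: le_trans (lee_wpmul2l _ mass) _; first by rewrite lee_fin powR_ge0.
rewrite -EFinM lee_fin /c powRM ?(ltW M0)//.
rewrite -[in leRHS](@mulr_powRB1 _ M) ?(ltW M0)//; last lra.
by rewrite le_eqVlt; apply/orP; left; apply/eqP; ring.
Qed.

End Assembly.

(** * Interpolation in q and the ranges where the inequality holds *)

Section Positive.
Context {R : realType}.
Notation mu := (@lebesgue_measure R).
Implicit Types (d b r p h t : R) (u g f k : R -> R).

Lemma powR_le_add z a p : 0 <= z -> 1 <= a -> a <= p -> z `^ a <= z + z `^ p :> R.
Proof.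
move=> z0 a1 ap; have [->|zn0] := eqVneq z 0.
  by rewrite powR0 ?add0r ?powR_ge0// gt_eqF//; lra.
have zp : 0 < z by rewrite lt_neqAle eq_sym zn0.
have [z1|/ltW z1] := leP z 1.
  by rewrite (le_trans (ge1r_powR _ _))// ?zp// lerDl powR_ge0.
by rewrite (le_trans (ler_powR z1 ap))// lerDr.
Qed.

(** With Y = u^2 s^(2 b), apply [powR_le_add] to z = Y / M. The linear term is the weighted mass.
    Since 2 p (b - (d - 1) / 2) = 1, Y^p / s is exactly (u^2 s^(d - 1))^p, and p - 1 of these
    factors are bounded by 4 h A, leaving the mass B. No bound on sup Y is needed. *)
Lemma int_pos_interpolate d u g h b r (C' : R) : 1 <= d -> H1w d u g -> 0 < h ->
  let A := fine (int_pos (fun t => g t ^+ 2 * wgt d t)) in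
  let M := A * h `^ (2 - d + 2 * b) in
  let p := ((b - (d - 1) / 2)^-1) / 2 in
  0 < A -> fine (int_pos (fun t => u t ^+ 2 * wgt d t)) = A * h ^+ 2 ->
  0 < b - (d - 1) / 2 -> 2 <= r -> r / 2 <= p -> 0 <= C' ->
  (int_pos (fun t => (u t ^+ 2 * (1 + t) `^ (2 * b - 1))%R) <= (C' * M)%:E)%E ->
  (int_pos (fun t => (`|u t| `^ r * (1 + t) `^ (b * r - 1))%R) <=
    ((C' + 4 `^ (p - 1)) * M `^ (r / 2))%:E)%E.
Proof.
move=> d1 H h0 A M p A0 BE; set y := b - (d - 1) / 2 => y0 r2 rp C'0 mass.
have meas_u := measurable_H1w d1 H.
have M0 : 0 < M by rewrite mulr_gt0// powR_gt0.
have bE : 2 * b = d - 1 + 2 * y by rewrite /y; field.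
have yp : 2 * y * p = 1 by rewrite /p -/y; field; rewrite gt_eqF.
have p1 : 1 <= p by lra.
have hA0 : 0 < 4 * (h * A) by rewrite !mulr_gt0.
(* Coefficients of the weighted mass and of the plain mass B after multiplying z + z^p by M^(r /
   2). *)
pose c1 := M `^ (r / 2) / M.
pose c2 := M `^ (r / 2) / M `^ p * (4 * (h * A)) `^ (p - 1).
have c10 : 0 <= c1 by rewrite mulr_ge0 ?powR_ge0 ?invr_ge0 ?(ltW M0).
have c20 : 0 <= c2 by rewrite !mulr_ge0 ?invr_ge0 ?powR_ge0.
apply: (@le_trans _ _ (c1%:E * int_pos (fun t => (u t ^+ 2 * (1 + t) `^ (2 * b - 1))%R) +
   c2%:E * int_pos (fun t => (u t ^+ 2 * wgt d t)%R))%E).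
  apply: int_pos_leD => //.
  - exact: measurable_integrand.
  - exact: measurable_mass.
  - exact: measurable_sqr_wgt.
  - by move=> t _; rewrite mulr_ge0 ?powR_ge0.
  - by move=> t _; rewrite mulr_ge0 ?sqr_ge0 ?powR_ge0.
  - by move=> t _; exact: sqr_wgt_ge0.
  move=> t t0; have s0 : 0 < 1 + t by lra.
  rewrite integrandE//; last lra.
  rewrite massE_pow//.
  set Y := u t ^+ 2 * (1 + t) `^ (2 * b).
  have Y0 : 0 <= Y by rewrite mulr_ge0 ?sqr_ge0 ?powR_ge0.
  have YE : Y `^ p = (u t ^+ 2 * wgt d t) `^ p * (1 + t).
    rewrite /Y bE powRD_gt0// mulrA powRM ?powR_ge0 ?sqr_wgt_ge0//.
    by rewrite -powRrM yp powRr1// ltW.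
  have YpE : Y `^ p <= (4 * (h * A)) `^ (p - 1) * (u t ^+ 2 * wgt d t) * (1 + t).
    rewrite YE; apply: ler_wpM2r; first exact: ltW.
    rewrite -[leLHS](@mulr_powRB1 _ _ p) ?sqr_wgt_ge0//; last lra.
    rewrite mulrC; apply: ler_wpM2r; first exact: sqr_wgt_ge0.
    apply: ge0_ler_powR; rewrite ?nnegrE ?sqr_wgt_ge0 ?(ltW hA0)//; first lra.
    exact: (sqr_wgt_le d1 H h0 BE).
  have Yr : Y `^ (r / 2) <= M `^ (r / 2) * (Y / M + Y `^ p / M `^ p).
    have -> : Y `^ (r / 2) = M `^ (r / 2) * (Y / M) `^ (r / 2).
      rewrite -powRM ?(ltW M0)//; last by rewrite divr_ge0// ltW.
      by rewrite mulrCA divff ?mulr1 ?gt_eqF.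
    rewrite ler_wpM2l ?powR_ge0//.
    have -> : Y `^ p / M `^ p = (Y / M) `^ p.
      rewrite powRM ?invr_ge0 ?(ltW M0)//; congr (_ * _).
      by rewrite -(powR_inv1 (ltW M0)) powRAC powR_inv1 ?powR_ge0.
    by apply: powR_le_add; rewrite ?divr_ge0// ?(ltW M0)//; lra.
  rewrite ler_pdivrMr//; apply: le_trans Yr _.
  rewrite mulrDr mulrDl; apply: lerD.
    by rewrite /c1 [leRHS](_ : _ = M `^ (r / 2) * (Y / M))//; field; rewrite !gt_eqF.
  apply: (@le_trans _ _ (M `^ (r / 2) / M `^ p *
     ((4 * (h * A)) `^ (p - 1) * (u t ^+ 2 * wgt d t) * (1 + t)))).
    rewrite mulrCA mulrC; apply: ler_wpM2l => //.
    by rewrite mulr_ge0 ?invr_ge0 ?powR_ge0.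
  by rewrite /c2 !mulrA.
rewrite (massE H) BE.
apply: (@le_trans _ _ (c1%:E * (C' * M)%:E + c2%:E * (A * h ^+ 2)%:E)%E).
  by rewrite leeD2r// lee_wpmul2l.
rewrite -!EFinM -EFinD lee_fin mulrDl; apply: lerD.
  by rewrite /c1 mulrCA divfK ?gt_eqF.
rewrite /c2 le_eqVlt; apply/orP; left; apply/eqP.
(* The exponent of h is (2 - d + 2 b) p = p + 1, so M^p = (h A)^(p - 1) B and the second term scales
   exactly. *)
have MpE : M `^ p = h `^ (p - 1) * A `^ (p - 1) * (A * h ^+ 2).
  rewrite /M powRM ?powR_ge0 ?(ltW A0)// -powRrM.
  have -> : (2 - d + 2 * b) * p = (p - 1) + 2.
    rewrite bE (_ : (2 - d + (d - 1 + 2 * y)) * p = p + 2 * y * p); last by ring.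
    by rewrite yp; ring.
  rewrite powRD_gt0// (powR_mulrn 2) ?(ltW h0)//.
  rewrite -[in LHS](@mulr_powRB1 _ A p) ?(ltW A0)//; last lra.
  by ring.
have hA : (4 * (h * A)) `^ (p - 1) = 4 `^ (p - 1) * (h `^ (p - 1) * A `^ (p - 1)).
  by rewrite powRM ?mulr_ge0 ?(ltW h0) ?(ltW A0)// powRM ?(ltW h0) ?(ltW A0).
rewrite hA MpE; field.
by rewrite !gt_eqF ?powR_gt0.
Qed.

Lemma Star_le_half d b (q : \bar R) : 1 <= d -> 0 < b -> d - 2 <= 2 * b ->
  2 * b <= d - 1 -> (2%:E <= q)%E -> Star d b q.
Proof.
move=> d1 b0 db bd q2; have b10 : 0 < b^-1 by rewrite invr_gt0.
have C0 : 0 <= 8 + b^-1 by lra.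
have C'0 : 0 <= 1 + 4 / b + 2 / b ^+ 2.
  by rewrite !addr_ge0// divr_ge0// ?exprn_ge0// ltW.
case: q q2 => [r||//].
- rewrite lee_fin => r2.
  apply: (@Star_of_scale _ _ _ _
    (((8 + b^-1) `^ (r / 2 - 1) * (1 + 4 / b + 2 / b ^+ 2)) `^ (2 / r))) => //.
    exact: powR_ge0.
  move=> u g h H h0 A A0 BE.
  apply: lhs_le; rewrite ?mulr_ge0 ?powR_ge0 ?(ltW A0)//; first lra.
  apply: int_pos_le_sup => //.
  + by rewrite mulr_gt0 ?powR_gt0.
  + exact: measurable_H1w d1 H.
  + by move=> t t0; exact: sup_le.
  + by apply: mass_le => //; lra.
- move=> _; apply: (@Star_of_scale _ _ _ _ (8 + b^-1)) => // [|u g h H h0 A A0 BE].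
    exact: leey.
  apply: ge_ereal_sup => x [t]; rewrite /= in_itv/= andbT => t0 <- {x}.
  by rewrite lee_fin real_normK ?num_real//; exact: sup_le.
Qed.

Lemma Star_gt_half d b (q : \bar R) : 1 <= d -> (d - 1) / 2 < b -> 2 * b <= d ->
  (2%:E <= q)%E -> (q <= ((b - (d - 1) / 2)^-1)%:E)%E -> Star d b q.
Proof.
move=> d1 db bd; case: q => [r||//]; last by rewrite leye_eq.
rewrite !lee_fin => r2 rb; have b0 : 0 < b by lra.
have C'0 : 0 <= 1 + 4 / b + 2 / b ^+ 2.
  by rewrite !addr_ge0// divr_ge0// ?exprn_ge0// ltW.
pose p := ((b - (d - 1) / 2)^-1) / 2.
apply: (@Star_of_scale _ _ _ _
  ((1 + 4 / b + 2 / b ^+ 2 + 4 `^ (p - 1)) `^ (2 / r))) => //.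
  exact: powR_ge0.
move=> u g h H h0 A A0 BE.
apply: lhs_le; rewrite ?(addr_ge0 C'0) ?mulr_ge0 ?powR_ge0 ?(ltW A0)//; first lra.
apply: (int_pos_interpolate d1 H h0) => //.
- by rewrite subr_gt0.
- by rewrite ler_wpM2r.
- by apply: mass_le => //; lra.
Qed.

Lemma Star_zero d : 1 <= d -> d < 2 -> Star d 0 +oo%E.
Proof.
move=> d1 d2; have d20 : 0 < (2 - d)^-1 by rewrite invr_gt0; lra.
apply: (@Star_of_scale _ _ _ _ (8 + 2 / (2 - d))) => //.
- exact: leey.
- lra.
move=> u g h H h0 A A0 BE.
apply: ge_ereal_sup => x [t]; rewrite /= in_itv/= andbT => t0 <- {x}.
rewrite lee_fin real_normK ?num_real// mulr0 powRr0 mulr1.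
by have := sup_le0 d1 H h0 BE d2 t0; rewrite mulr0.
Qed.

End Positive.

(** * Test functions *)

Section Bump.
Context {R : realType}.
Notation mu := (@lebesgue_measure R).
Implicit Types (x y t c : R) (k : R -> R).

Lemma is_derive_ln1D t : 0 <= t ->
  is_derive t 1 (fun s : R => ln (1 + s)) ((1 + t) `^ (-1)).
Proof.
move=> t0; have t1 : 0 < 1 + t by lra.
have ? := is_derive1_ln t1.
have h : is_derive t 1 (fun s : R => 1 + s) 1.
  by have := is_deriveD (is_derive_cst (1:R) t 1) (is_derive_id t (1:R)); rewrite add0r.
rewrite powR_inv1 ?(ltW t1)// -[X in is_derive _ _ _ X]mulr1.
exact: (@is_derive1_comp _ (@ln R) (fun s : R => 1 + s)).
Qed.

Lemma integral_powR1DN1 x y : 0 <= x -> x <= y ->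
  (\int[mu]_(t in `[x, y]) ((1 + t) `^ (-1))%:E = (ln (1 + y) - ln (1 + x))%:E)%E.
Proof.
move=> x0 xy.
have dF t : x <= t <= y -> is_derive t 1 (fun s : R => ln (1 + s)) ((1 + t) `^ (-1)).
  by move=> /andP[xt _]; exact: is_derive_ln1D (le_trans x0 xt).
rewrite (integral_deriv xy dF)// => t /andP[xt _].
exact: continuous_powR1D (le_trans x0 xt).
Qed.

Variables (d a b : R) (F f : R -> R) (CF Cf : R).
Hypotheses (d1 : 1 <= d) (a0 : 0 <= a) (ab : a <= b).
Hypotheses (mF : measurable_fun setT F) (mf : measurable_fun setT f).
Hypothesis Ff : forall x y, a <= x -> x <= y -> y <= b ->
  (\int[mu]_(t in `[x, y]) (f t)%:E = (F y - F x)%:E)%E.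
Hypothesis FC : forall t, a <= t <= b -> `|F t| <= CF.
Hypothesis fC : forall t, a <= t <= b -> `|f t| <= Cf.
Hypothesis Fb : F b = 0.
(** Vanishing at the left end is required only when a > 0: the half-line is open at 0, so a profile
    starting at a = 0 may have any value there. The ramps depend on this. *)
Hypothesis Fa : 0 < a -> F a = 0.

(** Projection onto [a, b]; composing F with it extends the profile by its end values, so no
    separate gluing at a and b is needed. *)
Definition clamp t := Num.max a (Num.min t b).
Definition bump t := F (clamp t).
Definition dbump : R -> R := f \_ `[a, b].

Let CF0 : 0 <= CF.
Proof. by apply: le_trans (FC (t := a) _) => //; rewrite lexx. Qed.

Let Cf0 : 0 <= Cf.
Proof. by apply: le_trans (fC (t := a) _) => //; rewrite lexx. Qed.

Lemma bump_in t : a <= t <= b -> bump t = F t.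
Proof. by move=> /andP[at_ tb]; rewrite /bump /clamp min_l// max_r. Qed.

Lemma bump_out t : 0 < t -> ~~ (a <= t <= b) -> bump t = 0.
Proof.
move=> t0; rewrite /bump /clamp negb_and -!ltNge => /orP[ta|bt].
  rewrite min_l ?max_l ?(ltW ta)// ?(le_trans (ltW ta))//.
  by rewrite Fa// (lt_trans t0).
by rewrite min_r ?(ltW bt)// max_r.
Qed.

Lemma dbump_in t : a <= t <= b -> dbump t = f t.
Proof. by move=> tab; rewrite /dbump patchE mem_setE in_itv/= tab. Qed.

Lemma dbump_out t : ~~ (a <= t <= b) -> dbump t = 0.
Proof. by move=> /negbTE tab; rewrite /dbump patchE mem_setE in_itv/= tab. Qed.

Lemma measurable_bump (D : set R) : measurable_fun D bump.
Proof.
apply: measurable_funTS; apply: (measurableT_comp mF).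
by apply: measurable_maxr => //; exact: measurable_minr.
Qed.

Lemma measurable_dbump (D : set R) : measurable_fun D dbump.
Proof.
apply: measurable_funTS; apply/(measurable_restrictT _ (measurable_itv _)).
exact: measurable_funTS.
Qed.

Lemma dbump_le t : `|dbump t| <= Cf.
Proof.
have [tab|tab] := boolP (a <= t <= b); first by rewrite dbump_in ?fC.
by rewrite dbump_out ?normr0.
Qed.

Lemma integrable_dbump x y : x <= y ->
  mu.-integrable `[x, y] (fun t => (dbump t)%:E).
Proof.
move=> xy; apply/integrableP; split.
  by apply/measurable_EFinP; exact: measurable_dbump.
apply: (@le_lt_trans _ _ (\int[mu]_(t in `[x, y]) Cf%:E)%E).
  apply: ge0_le_integral => //.
  - apply: measurableT_comp => //; apply/measurable_EFinP; exact: measurable_dbump.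
  - by move=> t _; rewrite lee_fin dbump_le.
by rewrite integral_segment_cst// ltry.
Qed.

(** If [x, y] meets [a, b], the intersection is the segment between the clamped ends; otherwise
    these ends coincide and both sides vanish. *)
Lemma integral_dbump x y : 0 < x -> x <= y ->
  (\int[mu]_(t in `[x, y]) (dbump t)%:E = (bump y - bump x)%:E)%E.
Proof.
move=> x0 xy.
have -> : (\int[mu]_(t in `[x, y]) (dbump t)%:E =
           \int[mu]_(t in `[x, y] `&` `[a, b]) (f t)%:E)%E.
  rewrite integral_mkcondr; apply: eq_integral => t _.
  by rewrite /dbump !patchE; case: ifP.
have clampE t : a <= clamp t <= b by rewrite /clamp le_max lexx/= ge_max ab ge_min lexx orbT.
have [xb|bx] := leP x b; last first.
  rewrite (_ : `[x, y] `&` `[a, b] = set0).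
    by rewrite integral_set0 /bump /clamp !min_r ?subrr// ltW// (lt_le_trans bx).
  apply/seteqP; split=> // t []; rewrite /= !in_itv/= => /andP[xt _] /andP[_ tb].
  by have := lt_le_trans bx (le_trans xt tb); rewrite ltxx.
have [ay|ya] := leP a y; last first.
  rewrite (_ : `[x, y] `&` `[a, b] = set0).
    by rewrite integral_set0 /bump /clamp !max_l ?subrr// ge_min ?(ltW ya)// (le_trans xy (ltW ya)).
  apply/seteqP; split=> // t []; rewrite /= !in_itv/= => /andP[_ ty] /andP[at_ _].
  by have := lt_le_trans ya (le_trans at_ ty); rewrite ltxx.
have -> : (`[x, y] `&` `[a, b] : set R) = `[clamp x, clamp y]%classic.
  rewrite /clamp (min_l xb) [Num.max a (Num.min y b)]max_r ?le_min ?ay//.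
  apply/seteqP; split=> t; rewrite /= !in_itv/= ge_max le_min.
    by move=> [/andP[-> ->] /andP[-> ->]].
  by move=> /andP[/andP[-> ->] /andP[-> ->]].
have [/andP[ax _] /andP[_ yb]] := (clampE x, clampE y).
by rewrite Ff// /clamp; apply: le_max2 => //; apply: le_min2.
Qed.


Lemma int_pos_support_le k k' :
  measurable_fun (`]0, +oo[ : set R) k ->
  (forall t, 0 < t -> 0 <= k t) -> (forall t, 0 < t -> ~~ (a <= t <= b) -> k t = 0) ->
  measurable_fun `[a, b] k' -> (forall t, a <= t <= b -> 0 <= k' t) ->
  (forall t, a <= t <= b -> k t <= k' t) ->
  (int_pos k <= \int[mu]_(t in `[a, b]) (k' t)%:E)%E.
Proof.
move=> mk k0 kout mk' k'0 kk'.
have -> : (int_pos k = \int[mu]_(t in `]0%R, +oo[ `&` `[a, b]) (k t)%:E)%E.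
  rewrite /int_pos integral_mkcondr; apply: eq_integral => t.
  rewrite inE/= in_itv/= andbT => t0.
  by rewrite patchE mem_setE in_itv/=; case: ifPn => // /(kout _ t0) ->.
apply: (@le_trans _ _ (\int[mu]_(t in `]0%R, +oo[ `&` `[a, b]) (k' t)%:E)%E).
  apply: ge0_le_integral => //.
  - exact: measurableI.
  - by move=> t []; rewrite /= !in_itv/= andbT => t0 _; rewrite lee_fin k0.
  - by apply/measurable_EFinP; apply: measurable_funS mk => // t [].
  - by apply/measurable_EFinP; apply: measurable_funS mk' => // t [].
  - by move=> t []; rewrite /= !in_itv/= => _ /kk'; rewrite lee_fin.
apply: ge0_subset_integral => //.
- exact: measurableI.
- exact/measurable_EFinP.
Qed.

Lemma int_pos_sqr_support_le (v : R -> R) (C : R) :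
  measurable_fun (`]0, +oo[ : set R) v ->
  (forall t, a <= t <= b -> `|v t| <= C) ->
  (forall t, 0 < t -> ~~ (a <= t <= b) -> v t = 0) ->
  (int_pos (fun t => (v t ^+ 2 * wgt d t)%R) <= (C ^+ 2 * wgt d b * (b - a))%:E)%E.
Proof.
move=> mv vC vout; rewrite -integral_segment_cst//.
apply: int_pos_support_le => //.
- exact: measurable_sqr_wgt.
- by move=> t _; exact: sqr_wgt_ge0.
- by move=> t t0 tab; rewrite vout// expr0n mul0r.
- by move=> t _; exact: sqr_wgt_ge0.
- move=> t tab; have /andP[at_ tb] := tab.
  apply: ler_pM; rewrite ?sqr_ge0 ?wgt_ge0//; last first.
    by apply: wgt_homo => //; exact: le_trans at_.
  by rewrite -real_normK ?num_real// lerXn2r ?nnegrE ?vC// (le_trans _ (vC _ tab)).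
Qed.

Lemma dbump_dirichlet_le :
  (int_pos (fun t => (dbump t ^+ 2 * wgt d t)%R) <= (Cf ^+ 2 * wgt d b * (b - a))%:E)%E.
Proof.
apply: int_pos_sqr_support_le; first exact: measurable_dbump.
  by move=> t _; exact: dbump_le.
by move=> t _; exact: dbump_out.
Qed.

Lemma bump_mass_le :
  (int_pos (fun t => (bump t ^+ 2 * wgt d t)%R) <= (CF ^+ 2 * wgt d b * (b - a))%:E)%E.
Proof.
apply: int_pos_sqr_support_le; first exact: measurable_bump.
  by move=> t tab; rewrite bump_in// FC.
exact: bump_out.
Qed.

Lemma H1w_bump : H1w d bump dbump.
Proof.
split.
- by move=> x y x0 xy; split; [exact: integrable_dbump|rewrite integral_dbump].
- exact: measurable_dbump.
- exact: le_lt_trans dbump_dirichlet_le (ltry _).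
- exact: le_lt_trans bump_mass_le (ltry _).
Qed.

End Bump.

(** * Testing the inequality: lower bounds on the left side *)

Section Negative.
Context {R : realType}.
Notation mu := (@lebesgue_measure R).
Implicit Types (d b r t : R) (u g k : R -> R).

Lemma int_pos_ge k (c x y : R) : 0 < x -> x <= y -> 0 <= c ->
  measurable_fun (`]0, +oo[ : set R) k -> (forall t, 0 < t -> 0 <= k t) ->
  (forall t, x <= t <= y -> c <= k t) -> ((c * (y - x))%:E <= int_pos k)%E.
Proof.
move=> x0 xy c0 mk k0 ck; rewrite -integral_segment_cst// -[leRHS]mul1e.
apply: le_int_pos => //; first exact: segment_pos.
by move=> t; rewrite /= in_itv/= mul1r => /ck.
Qed.

Lemma le_lhs_fin b r u (c : R) : 0 < r -> 0 <= c ->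
  (c%:E <= int_pos (fun t => (`|u t| `^ r * (1 + t) `^ (b * r - 1))%R))%E ->
  ((c `^ (2 / r))%:E <= lhs b r%:E u)%E.
Proof.
move=> r0 c0 I; rewrite /lhs -poweR_EFin; apply: gt0_ler_poweR => //.
- by rewrite divr_ge0// ltW.
- by rewrite in_itv/= leey lee_fin c0.
- rewrite in_itv/= leey int_pos_ge0// => t _.
  by rewrite mulr_ge0 ?powR_ge0.
Qed.

Lemma le_lhs_sup b u t : 0 < t ->
  ((u t ^+ 2 * (1 + t) `^ (2 * b))%:E <= lhs b +oo%E u)%E.
Proof.
move=> t0; apply: ereal_sup_ubound; exists t; first by rewrite /= in_itv/= t0.
by rewrite real_normK ?num_real.
Qed.

(** Allows upper bounds for A and B in place of exact values: for (d - 2) / 2 <= b <= d / 2 both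
    exponents are nonnegative, so the right side is monotone once K is replaced by |K|. *)
Lemma Star_bound d b (q : \bar R) : (d - 2) / 2 <= b -> b <= d / 2 -> Star d b q ->
  exists2 K : R, 0 <= K & forall u g (A B c : R), H1w d u g ->
    (int_pos (fun t => (g t ^+ 2 * wgt d t)%R) <= A%:E)%E ->
    (int_pos (fun t => (u t ^+ 2 * wgt d t)%R) <= B%:E)%E ->
    (c%:E <= lhs b q u)%E ->
    c <= K * (A `^ ((d - 2 * b) / 2) * B `^ (1 - (d - 2 * b) / 2)).
Proof.
move=> db bd [K SK]; exists `|K| => // u g A B c H hA hB hc.
have := le_trans hc (SK u g H); rewrite lee_fin => /le_trans; apply.
have A0 := dirichlet_ge0 d g; have B0 := mass_ge0 d u.
have {}hA : fine (int_pos (fun t => g t ^+ 2 * wgt d t)) <= A.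
  by rewrite -lee_fin -(dirichletE H).
have {}hB : fine (int_pos (fun t => u t ^+ 2 * wgt d t)) <= B.
  by rewrite -lee_fin -(massE H).
rewrite -mulrA; apply: (@le_trans _ _ (`|K| * ((fine (int_pos (fun t => g t ^+ 2 * wgt d t)))
    `^ ((d - 2 * b) / 2) * (fine (int_pos (fun t => u t ^+ 2 * wgt d t)))
    `^ (1 - (d - 2 * b) / 2)))).
  by rewrite ler_wpM2r ?mulr_ge0 ?powR_ge0// ler_norm.
have A'0 := le_trans A0 hA; have B'0 := le_trans B0 hB.
have th0 : 0 <= (d - 2 * b) / 2 by lra.
have th1 : 0 <= 1 - (d - 2 * b) / 2 by lra.
by rewrite ler_wpM2l//; apply: ler_pM; rewrite ?powR_ge0//; apply: ge0_ler_powR.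
Qed.

Lemma powR_unbounded (e C : R) : 0 < e -> (forall x, 2 <= x -> x `^ e <= C) -> False.
Proof.
move=> e0 h; pose x := 2 + (`|C| + 1) `^ (e^-1).
have x2 : 2 <= x by rewrite lerDl powR_ge0.
have C1 : 0 <= `|C| + 1 by have := normr_ge0 C; lra.
have : `|C| + 1 <= x `^ e.
  have <- : ((`|C| + 1) `^ (e^-1)) `^ e = `|C| + 1.
    by rewrite -powRrM mulVf ?gt_eqF// powRr1.
  by apply: ge0_ler_powR; rewrite ?nnegrE ?powR_ge0 ?(ltW e0)//;
    rewrite /x; have := powR_ge0 (`|C| + 1) e^-1; lra.
have := h _ x2; have := ler_norm C; lra.
Qed.

End Negative.

(** * The escaping bump, the linear ramp and the logarithmic ramp *)

Section Counterexamples.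
Context {R : realType}.
Notation mu := (@lebesgue_measure R).
Implicit Types (d b r t T L N : R) (u g k : R -> R).

Lemma exists_bump d T : 1 <= d -> 0 <= T -> exists u g, [/\ H1w d u g,
  (int_pos (fun t => (g t ^+ 2 * wgt d t)%R) <= (8 * wgt d (T + 2))%:E)%E,
  (int_pos (fun t => (u t ^+ 2 * wgt d t)%R) <= (8 * wgt d (T + 2))%:E)%E &
  forall t, T + 1 / 2 <= t <= T + 3 / 2 -> 1 / 2 <= u t].
Proof.
move=> d1 T0; have T2 : T <= T + 2 by lra.
(* A parabola of width 2 and height 1, at least 3/4 on the middle unit interval. The crude bound 2
   on F and f over length 2 produces the constant 8. *)
pose F t := (t - T) * (T + 2 - t); pose f t := 2 * (T + 1 - t).
have dF t : is_derive t 1 F (f t).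
  have dl := is_deriveB (is_derive_id t (1 : R)) (is_derive_cst T t (1 : R)).
  have dr := is_deriveB (is_derive_cst (T + 2) t (1 : R)) (is_derive_id t (1 : R)).
  apply: (is_derive_eq (is_deriveM dl dr)).
  rewrite !fctE /f /= /GRing.scale/=. ring.
have cf : continuous f.
  move=> t; apply: cvgM; first exact: cvg_cst.
  by apply: cvgB; [exact: cvg_cst|exact: cvg_id].
have mf : measurable_fun setT f by exact: continuous_measurable_fun.
have mF : measurable_fun setT F.
  apply: continuous_measurable_fun => t; apply: differentiable_continuous.
  by apply/derivable1_diffP; have dFt := dF t; exact: ex_derive.
have Ff x y : T <= x -> x <= y -> y <= T + 2 ->
    (\int[mu]_(t in `[x, y]) (f t)%:E = (F y - F x)%:E)%E.
  by move=> _ xy _; apply: integral_deriv => // t _; exact: cf.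
have FC t : T <= t <= T + 2 -> `|F t| <= 2.
  by rewrite /F => /andP[? ?]; rewrite ler_norml; apply/andP; split; nra.
have fC t : T <= t <= T + 2 -> `|f t| <= 2.
  by rewrite /f => /andP[? ?]; rewrite ler_norml; apply/andP; split; lra.
have Fb : F (T + 2) = 0 by rewrite /F subrr mulr0.
have Fa : 0 < T -> F T = 0 by rewrite /F subrr mul0r.
have E8 : 2 ^+ 2 * wgt d (T + 2) * (T + 2 - T) = 8 * wgt d (T + 2) by ring.
exists (bump T (T + 2) F), (dbump T (T + 2) f); split.
- exact: (H1w_bump (CF := 2) (Cf := 2)).
- by rewrite -E8; exact: dbump_dirichlet_le.
- by rewrite -E8; exact: bump_mass_le.
- move=> t /andP[t1 t2]; rewrite bump_in; last by apply/andP; split; lra.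
  by rewrite /F; nra.
Qed.

(** Slope -1 / L over length L gains L^(-2) in the Dirichlet integral relative to the mass bound. *)
Lemma exists_ramp d L : 1 <= d -> 1 <= L -> exists u g, [/\ H1w d u g,
  (int_pos (fun t => (g t ^+ 2 * wgt d t)%R) <= (wgt d L / L)%:E)%E,
  (int_pos (fun t => (u t ^+ 2 * wgt d t)%R) <= (wgt d L * L)%:E)%E &
  forall t, 0 <= t <= L / 2 -> 1 / 2 <= u t].
Proof.
move=> d1 L1; have L0 : 0 < L by lra.
have Li : L * L^-1 = 1 by rewrite mulfV// gt_eqF.
have Li0 : 0 < L^-1 by rewrite invr_gt0.
pose F t := 1 - L^-1 * t; pose f t := - L^-1.
have dF t : is_derive t 1 F (f t).
  apply: (is_derive_eq (is_deriveB (is_derive_cst (1 : R) t (1 : R))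
    (is_deriveZ L^-1 (is_derive_id t (1 : R))))).
  by rewrite /f /GRing.scale/=; ring.
have cf : continuous f by move=> t; exact: cvg_cst.
have mf : measurable_fun setT f by exact: continuous_measurable_fun.
have mF : measurable_fun setT F.
  apply: continuous_measurable_fun => t; apply: differentiable_continuous.
  by apply/derivable1_diffP; have dFt := dF t; exact: ex_derive.
have Ff x y : 0 <= x -> x <= y -> y <= L ->
    (\int[mu]_(t in `[x, y]) (f t)%:E = (F y - F x)%:E)%E.
  by move=> _ xy _; apply: integral_deriv => // t _; exact: cf.
have FC t : 0 <= t <= L -> `|F t| <= 1.
  by rewrite /F => /andP[? ?]; rewrite ler_norml; apply/andP; split; nra.
have fC t : 0 <= t <= L -> `|f t| <= L^-1.
  by move=> _; rewrite /f normrN gtr0_norm.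
have Fb : F L = 0 by rewrite /F mulrC Li subrr.
have Fa : 0 < (0 : R) -> F 0 = 0 by rewrite ltxx.
have EA : L^-1 ^+ 2 * wgt d L * (L - 0) = wgt d L / L by field; rewrite gt_eqF.
have EB : 1 ^+ 2 * wgt d L * (L - 0) = wgt d L * L by ring.
exists (bump 0 L F), (dbump 0 L f); split.
- by apply: (H1w_bump (CF := 1) (Cf := L^-1)) => //; exact: ltW.
- by rewrite -EA; apply: dbump_dirichlet_le => //; exact: ltW.
- by rewrite -EB; apply: bump_mass_le => //; exact: ltW.
- move=> t /andP[t1 t2]; rewrite bump_in; last by apply/andP; split; lra.
  by rewrite /F; nra.
Qed.

(** For d = 2 the profile ln ((1 + N) / (1 + t)) has |u'|^2 s = 1 / s, so its energy is at most ln
    (1 + N), while u(1)^2 grows like the square of that logarithm. *)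
Lemma exists_log_ramp N : 1 <= N -> exists u g, [/\ H1w 2 u g,
  (int_pos (fun t => (g t ^+ 2 * wgt 2 t)%R) <= (ln (1 + N))%:E)%E &
  u 1 = ln (1 + N) - ln 2].
Proof.
move=> N1; have N0 : 0 <= N by lra.
pose F t := ln (1 + N) - ln (1 + t); pose f t := - (1 + t) `^ (-1).
have mf : measurable_fun setT f by apply: measurableT_comp => //; exact: measurable_powR1D.
have mF : measurable_fun setT F.
  apply: measurable_funB => //; apply: (measurableT_comp (@measurable_ln R)).
  exact: measurable_funD.
have Ff x y : 0 <= x -> x <= y -> y <= N ->
    (\int[mu]_(t in `[x, y]) (f t)%:E = (F y - F x)%:E)%E.
  move=> x0 xy _; apply: integral_deriv => // t /andP[xt _].
  - have t0 := le_trans x0 xt; have dl := is_derive_ln1D t0.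
    have := is_deriveB (is_derive_cst (ln (1 + N)) t (1 : R)) dl.
    by rewrite sub0r.
  - by apply: cvgN; exact: continuous_powR1D (le_trans x0 xt).
have FC t : 0 <= t <= N -> `|F t| <= ln (1 + N).
  move=> /andP[t0 tN]; rewrite ger0_norm /F ?subr_ge0 ?ler_ln ?posrE; [|lra..].
  by rewrite gerBl ln_ge0//; lra.
have fC t : 0 <= t <= N -> `|f t| <= 1.
  move=> /andP[t0 tN]; rewrite normrN ger0_norm ?powR_ge0// powR_inv1; last lra.
  by rewrite invf_le1; lra.
have Fb : F N = 0 by rewrite /F subrr.
have Fa : 0 < (0 : R) -> F 0 = 0 by rewrite ltxx.
exists (bump 0 N F), (dbump 0 N f); split.
- by apply: (H1w_bump (CF := ln (1 + N)) (Cf := 1)) => //; lra.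
- have -> : ((ln (1 + N))%:E = \int[mu]_(t in `[0%R, N]) ((1 + t) `^ (-1))%:E)%E.
    by rewrite integral_powR1DN1// addr0 ln1 subr0.
  apply: int_pos_support_le => //.
  + by apply: measurable_sqr_wgt; exact: measurable_dbump.
  + by move=> t _; exact: sqr_wgt_ge0.
  + by move=> t _ tN; rewrite dbump_out// expr0n mul0r.
  + exact: measurable_powR1D.
  + by move=> t _; exact: powR_ge0.
  + move=> t tN; have /andP[t0 _] := tN; rewrite dbump_in// /f sqrrN /wgt.
    have s0 : 0 < 1 + t by lra.
    rewrite expr2 -mulrA -powRD_gt0// (_ : -1 + (2 - 1) = 0); last by ring.
    by rewrite powRr0 mulr1.
- by rewrite bump_in ?ler01.
Qed.

End Counterexamples.

(** * Failure of the inequality *)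

Section Failure.
Context {R : realType}.
Notation mu := (@lebesgue_measure R).
Implicit Types (d b r t T L N : R) (u g k : R -> R).

(** Here e is 2 / q, read as 0 for q = oo; the assumption on q says precisely 2 / q < 2 b - (d -
    1). *)
Lemma lhs_far_ge d b (q : \bar R) : 1 <= d -> (d - 1) / 2 < b ->
  (((b - (d - 1) / 2)^-1)%:E < q)%E ->
  exists2 e : R, e < 2 * b - (d - 1) & forall u T, 0 <= T ->
    measurable_fun (`]0, +oo[ : set R) u ->
    (forall t, T + 1 / 2 <= t <= T + 3 / 2 -> 1 / 2 <= u t) ->
    ((1 / 4 * (1 + T) `^ (2 * b - e))%:E <= lhs b q u)%E.
Proof.
move=> d1 db; set y := b - (d - 1) / 2; have y0 : 0 < y by rewrite subr_gt0.
have yi0 : 0 < y^-1 by rewrite invr_gt0.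
have yE : 2 * b - (d - 1) = 2 * y by rewrite /y; field.
have yb : y <= b by rewrite /y; lra.
case: q => [r||//].
- rewrite lte_fin => yr; have r0 : 0 < r by lra.
  have ry : 1 < r * y by rewrite -ltr_pdivrMr// div1r.
  (* Follows from r y > 1 and y <= b; the weight is then nondecreasing and at least its value at
     T. *)
  have br : 0 <= b * r - 1 by nra.
  exists (2 / r).
    by rewrite yE ltr_pdivrMr//; nra.
  move=> u T T0 meas_u uT.
  pose c := 2^-1 `^ r * (1 + T) `^ (b * r - 1).
  have -> : 1 / 4 * (1 + T) `^ (2 * b - 2 / r) = c `^ (2 / r).
    rewrite /c powRM ?powR_ge0// -!powRrM.
    have -> : r * (2 / r) = 2%:R by field; rewrite gt_eqF.
    have -> : (b * r - 1) * (2 / r) = 2 * b - 2 / r by field; rewrite gt_eqF.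
    by rewrite (powR_mulrn 2)//; congr (_ * _); field.
  apply: le_lhs_fin => //; first by rewrite mulr_ge0 ?powR_ge0.
  have -> : c = c * (T + 3 / 2 - (T + 1 / 2)) by field.
  apply: int_pos_ge; [lra|lra|by rewrite mulr_ge0 ?powR_ge0|exact: measurable_integrand| |].
    by move=> t _; rewrite mulr_ge0 ?powR_ge0.
  move=> t tT; have ut := uT _ tT; have /andP[t1 t2] := tT.
  apply: ler_pM; rewrite ?powR_ge0//.
    have := ler_norm (u t) => un; apply: ge0_ler_powR; rewrite ?nnegrE//; lra.
  by apply: ge0_ler_powR; rewrite ?nnegrE; lra.
- move=> _; exists 0; first by rewrite yE; lra.
  move=> u T T0 _ uT; have T1 : 0 < T + 1 by lra.
  apply: le_trans (le_lhs_sup b u T1); rewrite lee_fin subr0.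
  have ut : 1 / 2 <= u (T + 1) by apply: uT; apply/andP; split; lra.
  apply: ler_pM; rewrite ?powR_ge0//; first by rewrite expr2; nra.
  by apply: ge0_ler_powR; rewrite ?nnegrE; lra.
Qed.

(** With x = 1 + T, both norms are of order x^(d - 1) and their exponents sum to 1, whereas the left
    side is at least of order x^(2 b - e) with 2 b - e > d - 1. The factor 3 comes from x + 2 <= 3
    x. *)
Lemma not_Star_far d b (q : \bar R) : 1 <= d -> (d - 2) / 2 <= b -> b <= d / 2 ->
  (d - 1) / 2 < b -> (((b - (d - 1) / 2)^-1)%:E < q)%E -> ~ Star d b q.
Proof.
move=> d1 db bd hb hq /(Star_bound db bd)[K K0 SK].
have [e eb lo] := lhs_far_ge d1 hb hq.
apply: (@powR_unbounded _ (2 * b - e - (d - 1)) (K * (8 * 3 `^ (d - 1)) * 4)).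
  by lra.
move=> x x2; have T0 : 0 <= x - 1 by lra.
have [u [g [H hA hB hu]]] := exists_bump d1 T0.
have h := SK u g _ _ _ H hA hB (lo u _ T0 (measurable_H1w d1 H) hu).
have w0 : 0 < wgt d (x - 1 + 2) by rewrite powR_gt0//; lra.
have x0 : 0 < x by lra.
have xE : (1 + (x - 1)) `^ (2 * b - e) = x `^ (2 * b - e - (d - 1)) * x `^ (d - 1).
  by rewrite -powRD_gt0//; congr (_ `^ _); ring.
rewrite -powRD_gt0 in h; last by rewrite mulr_gt0.
rewrite (_ : (d - 2 * b) / 2 + (1 - (d - 2 * b) / 2) = 1) in h; last by ring.
rewrite powRr1 in h; last by rewrite mulr_ge0// ltW.
rewrite xE in h.
have wx : wgt d (x - 1 + 2) <= 3 `^ (d - 1) * x `^ (d - 1).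
  rewrite /wgt -powRM ?(ltW x0)//; apply: ge0_ler_powR; rewrite ?nnegrE; lra.
have xd : 0 < x `^ (d - 1) by rewrite powR_gt0.
rewrite -(ler_pM2r xd).
have KW : K * (8 * wgt d (x - 1 + 2)) <= K * (8 * (3 `^ (d - 1) * x `^ (d - 1))).
  by rewrite !ler_wpM2l.
lra.
Qed.

(** The powers of the weight combine to one, those of L to 1 - 2 theta = 2 b - (d - 1); then 1 + L
    <= 2 L. *)
Lemma ramp_rhs_le d b L : 1 <= d -> (d - 2) / 2 <= b -> b <= d / 2 -> 1 <= L ->
  (wgt d L / L) `^ ((d - 2 * b) / 2) * (wgt d L * L) `^ (1 - (d - 2 * b) / 2)
    <= 2 `^ (d - 1) * L `^ (2 * b).
Proof.
move=> d1 db bd L1; have L0 : 0 < L by lra.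
have w0 : 0 < wgt d L by rewrite powR_gt0//; lra.
set th := (d - 2 * b) / 2.
have -> : (wgt d L / L) `^ th * (wgt d L * L) `^ (1 - th) = wgt d L * L `^ (2 * b - (d - 1)).
  rewrite -(powR_inv1 (ltW L0)) !powRM ?powR_ge0 ?(ltW w0) ?(ltW L0)//.
  rewrite -powRrM mulrACA -!powRD_gt0//.
  rewrite (_ : th + (1 - th) = 1); last by ring.
  by rewrite powRr1 ?(ltW w0)//; congr (_ * _ `^ _); rewrite /th; field.
apply: (@le_trans _ _ (2 `^ (d - 1) * L `^ (d - 1) * L `^ (2 * b - (d - 1)))).
  rewrite ler_wpM2r ?powR_ge0// -powRM ?(ltW L0)//.
  by apply: ge0_ler_powR; rewrite ?nnegrE; lra.
rewrite -mulrA -powRD_gt0// (_ : d - 1 + _ = 2 * b)//; ring.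
Qed.

Lemma lhs_ramp_ge b (q : \bar R) : b < 0 -> (2%:E <= q)%E ->
  exists2 c : R, 0 < c & forall u, measurable_fun (`]0, +oo[ : set R) u ->
    (forall t, 0 <= t <= 1 -> 1 / 2 <= u t) -> (c%:E <= lhs b q u)%E.
Proof.
move=> b0; case: q => [r||//].
- rewrite lee_fin => r2; have r0 : 0 < r by lra.
  (* Integration over [1/2, 1], where u >= 1/2 and the decreasing weight is at least its value at s
     = 2. *)
  pose c := 2^-1 `^ r * 2 `^ (b * r - 1) * (1 - 1 / 2).
  have c0 : 0 < c by rewrite !mulr_gt0 ?powR_gt0//; lra.
  exists (c `^ (2 / r)); first exact: powR_gt0.
  move=> u meas_u hu; apply: le_lhs_fin => //; first exact: ltW.
  apply: int_pos_ge; [lra|lra|by rewrite mulr_ge0 ?powR_ge0|exact: measurable_integrand| |].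
    by move=> t _; rewrite mulr_ge0 ?powR_ge0.
  move=> t /andP[t1 t2]; have ut : 1 / 2 <= u t by apply: hu; apply/andP; split; lra.
  apply: ler_pM; rewrite ?powR_ge0//.
    have := ler_norm (u t) => un; apply: ge0_ler_powR; rewrite ?nnegrE//; lra.
  by apply: le0_ler_powR; [nra|lra|lra].
- move=> _; exists (1 / 4 * (1 + 1) `^ (2 * b)).
    by rewrite mulr_gt0 ?powR_gt0//; lra.
  move=> u _ hu; apply: le_trans (le_lhs_sup b u ltr01); rewrite lee_fin.
  have ut : 1 / 2 <= u 1 by apply: hu; rewrite ler01 lexx.
  by rewrite ler_wpM2r ?powR_ge0// expr2; nra.
Qed.

(** The left side stays above a fixed c because all ramps with L >= 2 are at least 1/2 on [0, 1],
    while the right side is at most a multiple of L^(2 b), which tends to 0. *)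
Lemma not_Star_neg d b (q : \bar R) : 1 <= d -> (d - 2) / 2 <= b -> b < 0 ->
  (2%:E <= q)%E -> ~ Star d b q.
Proof.
move=> d1 db b0 q2; have bd : b <= d / 2 by lra.
move=> /(Star_bound db bd)[K K0 SK].
have [c c0 lo] := lhs_ramp_ge b0 q2.
apply: (@powR_unbounded _ (- (2 * b)) (K * 2 `^ (d - 1) / c)); first lra.
move=> L L2; have L1 : 1 <= L by lra.
have [u [g [H hA hB hu]]] := exists_ramp d1 L1.
have hu1 t : 0 <= t <= 1 -> 1 / 2 <= u t.
  by move=> /andP[t0 t1]; apply: hu; apply/andP; split; lra.
have := SK u g _ _ _ H hA hB (lo u (measurable_H1w d1 H) hu1).
move=> /le_trans /(_ (ler_wpM2l K0 (ramp_rhs_le d1 db bd L1))) h.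
have Lb : 0 < L `^ (2 * b) by rewrite powR_gt0//; lra.
rewrite powRN ler_pdivlMr// ler_pdivrMl//; lra.
Qed.

(** At b = 0 the right side stays bounded along the ramps, but the integral of |u|^r / s over
    [1, L / 2] grows like ln L. [C] is the bound that would follow for this logarithm, and L = 2 exp
    s is chosen to exceed it. *)
Lemma not_Star_zero d r : 1 <= d -> d <= 2 -> 2 <= r -> ~ Star d 0 r%:E.
Proof.
move=> d1 d2 r2; have r0 : 0 < r by lra.
have db : (d - 2) / 2 <= 0 by lra.
have bd : 0 <= d / 2 by lra.
move=> /(Star_bound db bd)[K K0 SK].
pose C := (K * 2 `^ (d - 1)) `^ (r / 2) / 2^-1 `^ r.
pose s := `|C| + ln 2 + 1.
have ln2 : 0 <= ln 2 :> R by rewrite ln_ge0//; lra.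
have s0 : 0 <= s by have := normr_ge0 C; rewrite /s; lra.
have es1 : 1 <= expR s by rewrite -expR0 ler_expR.
pose L := 2 * expR s; have L1 : 1 <= L by rewrite /L; lra.
have [u [g [H hA hB hu]]] := exists_ramp d1 L1.
have L2 : L / 2 = expR s by rewrite /L mulrC mulKf.
pose c := 2^-1 `^ r * (ln (1 + L / 2) - ln (1 + 1)).
have lnL : ln 2 <= ln (1 + L / 2).
  by rewrite ler_ln ?posrE; lra.
have c0 : 0 <= c by rewrite mulr_ge0 ?powR_ge0// subr_ge0.
have meas_u := measurable_H1w d1 H.
have lo : ((c `^ (2 / r))%:E <= lhs 0 r%:E u)%E.
  apply: le_lhs_fin => //; rewrite /c EFinM -integral_powR1DN1//; last by lra.
  rewrite -ge0_integralZl//; last 2 first.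
  - by apply/measurable_EFinP; exact: measurable_powR1D.
  - by move=> t _; rewrite lee_fin powR_ge0.
  under eq_integral do rewrite -EFinM.
  rewrite -[leRHS]mul1e; apply: le_int_pos => //.
  - exact: segment_pos.
  - exact: measurable_integrand.
  - by move=> t _; rewrite mulr_ge0 ?powR_ge0.
  - by apply: measurable_funM => //; exact: measurable_powR1D.
  - by move=> t _; rewrite mulr_ge0 ?powR_ge0.
  - move=> t; rewrite /= in_itv/= => /andP[t1 t2]; rewrite mul1r mul0r sub0r.
    rewrite ler_wpM2r ?powR_ge0//.
    have ut : 1 / 2 <= u t by apply: hu; apply/andP; split; lra.
    have := ler_norm (u t) => un; apply: ge0_ler_powR; rewrite ?nnegrE//; lra.
have := SK u g _ _ _ H hA hB lo.
move=> /le_trans /(_ (ler_wpM2l K0 (ramp_rhs_le d1 db bd L1))).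
rewrite mulr0 powRr0 mulr1 => h.
have h' : c <= (K * 2 `^ (d - 1)) `^ (r / 2).
  have <- : (c `^ (2 / r)) `^ (r / 2) = c.
    by rewrite -powRrM (_ : 2 / r * (r / 2) = 1) ?powRr1//; field; rewrite gt_eqF.
  by apply: ge0_ler_powR; rewrite ?nnegrE ?powR_ge0 ?mulr_ge0 ?powR_ge0//; lra.
have hC : ln (1 + L / 2) - ln (1 + 1) <= C.
  by rewrite /C ler_pdivlMr ?powR_gt0// mulrC.
have sl : s <= ln (1 + L / 2).
  by rewrite -{1}(expRK s) ler_ln ?posrE ?expR_gt0//; lra.
have := ler_norm C; rewrite /s in sl; lra.
Qed.

(** Here theta = 1, and N is chosen so that u(1) = s = K + 1 and ln (1 + N) = ln 2 + s. The
    inequality would read (K + 1)^2 <= K (ln 2 + K + 1), impossible since ln 2 <= 1. *)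
Lemma not_Star_log : ~ Star (2 : R) 0 +oo%E.
Proof.
have [db bd] : (2 - 2) / 2 <= 0 :> R /\ 0 <= 2 / 2 :> R by split; lra.
move=> /(Star_bound db bd)[K K0 SK].
pose s := K + 1; pose N := 2 * expR s - 1.
have es1 : 1 <= expR s by rewrite -expR0 ler_expR /s; lra.
have N1 : 1 <= N by rewrite /N; lra.
have [u [g [H hA u1]]] := exists_log_ramp N1.
have lnE : ln (1 + N) = ln 2 + s.
  by rewrite /N addrCA subrr addr0 lnM ?posrE ?expR_gt0// expRK.
(* The mass enters with exponent 0, so its own finite value serves as the bound. *)
have hB : (int_pos (fun t => (u t ^+ 2 * wgt 2 t)%R) <=
    (fine (int_pos (fun t => (u t ^+ 2 * wgt 2 t)%R)))%:E)%E by rewrite -(massE H).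
have := SK u g _ _ _ H hA hB (le_lhs_sup 0 u ltr01).
rewrite mulr0 subr0 divff// subrr !powRr0 !mulr1 u1 lnE powRr1; last first.
  by rewrite addr_ge0 ?ln_ge0//; rewrite /s; lra.
rewrite addrAC subrr add0r expr2 /s => h.
have ln2 : ln 2 <= 1 :> R.
  by have := @le_ln1Dx R 1; rewrite (_ : 1 + 1 = 2)//; apply; lra.
nra.
Qed.

End Failure.

(** * The six parameter ranges *)

Theorem theorem6p1 (R : realType) (d beta : R) :
  1 <= d -> (d - 2) / 2 <= beta -> beta <= d / 2 ->
  ((((1 < d /\ d <= 2) /\ (0 < beta /\ beta <= (d - 1) / 2)) \/
     (2 < d /\ ((d - 2) / 2 <= beta /\ beta <= (d - 1) / 2))) ->
     forall q : \bar R, (2%:E <= q)%E -> Star d beta q) /\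
  ((d - 1) / 2 < beta ->
     forall q : \bar R, (2%:E <= q)%E -> (q <= ((beta - (d - 1) / 2)^-1)%:E)%E ->
     Star d beta q) /\
  (d < 2 -> beta = 0 -> Star d beta +oo%E) /\
  (d <= 2 -> - ((2 - d) / 2) <= beta -> beta <= 0 ->
     forall q : R, 2 <= q -> ~ Star d beta q%:E) /\
  ((d < 2 /\ - ((2 - d) / 2) <= beta /\ beta < 0) \/ (d = 2 /\ beta = 0) ->
     ~ Star d beta +oo%E) /\
  ((d - 1) / 2 < beta ->
     forall q : \bar R, (((beta - (d - 1) / 2)^-1)%:E < q)%E -> ~ Star d beta q).
Proof.
move=> d1 db bd; split; [|split; [|split; [|split; [|split]]]].
(* For d > 2 the positivity of beta comes from (d - 2) / 2 <= beta. *)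
- move=> h q q2; apply: Star_le_half => //; case: h => [[[? ?] [? ?]]|[? [? ?]]]; lra.
- by move=> hb q q2 qb; apply: Star_gt_half => //; lra.
- by move=> d2 ->; exact: Star_zero.
- move=> d2 _ b0 q q2; move: b0; rewrite le_eqVlt => /predU1P[->|b0].
    exact: not_Star_zero.
  by apply: not_Star_neg => //; rewrite lee_fin.
- move=> [[d2 [_ b0]]|[-> ->]]; last exact: not_Star_log.
  by apply: not_Star_neg => //; exact: leey.
- by move=> hb q; exact: not_Star_far.
Qed.
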